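(* Let $\mathbf{F}$ be a finite field with $q$ elements, let $(G,\mathbf{V})$ be the infinite symplectic group over $\mathbf{F}$, and let $\Theta(G;\mathbf{V})$ be its universal measure ring relative to $\mathbf{V}$. Let $$\phi\colon\Theta(G;\mathbf{V})\to\mathbb{Z}[1/q][t],\qquad \phi([X_{a,b}])=P_{a,b}(t)$$ be the ring homomorphism obtained by counting embeddings, as defined in the context. Then $\phi$ is an isomorphism after inverting $q$.
   Context: A structure is an $\mathbf{F}$-vector space with an alternating bilinear form; an embedding is an injective linear map preserving forms. $\mathbf{V}$ has basis $\{e_i,f_i\}_{i\ge1}$ and form $\langle e_i,e_j\rangle=\langle f_i,f_j\rangle=0$, $\langle e_i,f_j\rangle=\delta_{i,j}$; $G$ is its group of form-preserving linear automorphisms. $V_{m,n}$ is the space of dimension $2m+n$ that is the orthogonal sum of a non-degenerate symplectic space of dimension $2m$ and an $n$-dimensional space with zero form. $X_{m,n}$ is the set of embeddings $V_{m,n}\to\mathbf{V}$, with its transitive $G$-action by post-composition. A transitive $G$-set is $\mathbf{V}$-smooth if its stabilizers are pointwise stabilizers $G(A)$ of finite subsets $A\subset\mathbf{V}$; these are exactly the $X_{m,n}$ up to isomorphism. $\Theta(G;\mathbf{V})$ is the commutative ring generated by symbols $[f]$, for $f\colon Y\to X$ a map of transitive $\mathbf{V}$-smooth $G$-sets, modulo the relations: (a) $[f]=1$ if $f$ is an isomorphism; (b) $[f\circ g]=[f][g]$ for composable maps; (c) $[f]=\sum_i[f'_i]$ whenever $X'\to X$ is a map of transitive $\mathbf{V}$-smooth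 $G$-sets, $Y\times_XX'=\bigsqcup_iY'_i$ is the orbit decomposition, and $f'_i\colon Y'_i\to X'$ is the projection. For a transitive $\mathbf{V}$-smooth $G$-set $X$, $[X]:=[X\to\mathrm{pt}]$. $P_{a,b}(t)\in\mathbb{Z}[1/q][t]$ is the polynomial such that $P_{a,b}(q^{2m})$ is the number of embeddings $V_{a,b}\to V_{m,0}$ for all $m\ge0$. For a map $f\colon Y\to X$ with $X=X_{a,b}$, $Y=X_{a',b'}$ (so $f$ is restriction along an embedding $V_{a,b}\to V_{a',b'}$), let $\nu_m(f)$ be the number of extensions of an embedding $V_{a,b}\to V_{m,0}$ to an embedding $V_{a',b'}\to V_{m,0}$ (independent of the chosen embedding; defined for $m$ large). Then $\phi([f])$ is the unique polynomial whose value at $t=q^{2m}$ is $\nu_m(f)$ for all sufficiently large $m$. *)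

(* Defs.v *)
From HB Require Import structures.
From mathcomp Require Import all_boot all_order all_algebra.
From mathcomp Require Import finmap.
From mathcomp Require Import boolp.
From mathcomp.multinomials Require Import monalg.
From mathcomp Require Import ring zify.

Set Implicit Arguments.
Unset Strict Implicit.
Unset Printing Implicit Defensive.

Import GRing.Theory.
Local Open Scope ring_scope.
Local Open Scope quotient_scope.

HB.mixin Record Lmodule_hasAltForm (F : fieldType) V of GRing.Lmodule F V := {
  altform : V -> V -> F;
  altform_scalarl : forall v, scalar (altform^~ v);
  altform_scalarr : forall u, scalar (altform u);
  altform_alternating : forall v, altform v v = 0
}.

#[short(type="altSpaceType")]
HB.structure Definition AltSpace (F : fieldType) :=
  {V of Lmodule_hasAltForm F V & GRing.Lmodule F V}.

Section Embeddings.
Variable F : fieldType.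

Definition is_embedding (U W : altSpaceType F) (f : U -> W) : Prop :=
  [/\ linear f, injective f & forall u v, altform (f u) (f v) = altform u v].

Record embedding (U W : altSpaceType F) := Embedding {
  emb_fun :> U -> W;
  embP : is_embedding emb_fun
}.

Lemma is_embedding_comp (U V W : altSpaceType F) (f : V -> W) (g : U -> V) :
  is_embedding f -> is_embedding g -> is_embedding (f \o g).
Proof.
move=> [fl fi ff] [gl gi gf]; split=> [a u v /=||u v /=].
- by rewrite gl fl.
- exact: inj_comp.
- by rewrite ff gf.
Qed.

Lemma embedding_eq (U W : altSpaceType F) (f g : embedding U W) :
  f =1 g -> f = g.
Proof.
case: f g => [f fP] [g gP] /= /funext fg; rewrite fg in fP *.
by congr Embedding; apply: Prop_irrelevance.
Qed.

End Embeddings.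

Section AutomorphismGroup.
Variables (F : fieldType) (W : altSpaceType F).

Record aut := Aut {
  aut_fun :> W -> W;
  aut_inv : W -> W;
  aut_funK : cancel aut_fun aut_inv;
  aut_invK : cancel aut_inv aut_fun;
  aut_linear : linear aut_fun;
  aut_form : forall u v, altform (aut_fun u) (aut_fun v) = altform u v
}.

Lemma aut_eq (g h : aut) : g =1 h -> g = h.
Proof.
case: g h => [g g' gK g'K gl gf] [h h' hK h'K hl hf] /= /funext gh.
rewrite gh in gK g'K gl gf *.
have g'h' : g' = h' by apply/funext => x; rewrite -{1}[x]h'K gK.
rewrite g'h' in gK g'K *.
by congr Aut; apply: Prop_irrelevance.
Qed.

Lemma aut_embedding (g : aut) : is_embedding g.
Proof.
by split; [exact: aut_linear | exact: can_inj (@aut_funK g) | exact: aut_form].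
Qed.

Definition aut1 : aut :=
  @Aut idfun idfun (fun=> erefl) (fun=> erefl) (fun _ _ _ => erefl)
    (fun _ _ => erefl).

Lemma autM_linear (g h : aut) : linear (g \o h).
Proof. by move=> a u v /=; rewrite !aut_linear. Qed.

Lemma autM_form (g h : aut) (u v : W) :
  altform ((g \o h) u) ((g \o h) v) = altform u v.
Proof. by rewrite /= !aut_form. Qed.

Definition autM (g h : aut) : aut :=
  @Aut (g \o h) (aut_inv h \o aut_inv g) (can_comp (@aut_funK g) (@aut_funK h))
    (can_comp (@aut_invK h) (@aut_invK g)) (@autM_linear g h) (@autM_form g h).

Lemma autV_linear (g : aut) : linear (aut_inv g).
Proof.
move=> a u v; apply: (can_inj (@aut_funK g)).
by rewrite aut_linear !aut_invK.
Qed.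

Lemma autV_form (g : aut) (u v : W) :
  altform (aut_inv g u) (aut_inv g v) = altform u v.
Proof. by rewrite -(aut_form g) !aut_invK. Qed.

Definition autV (g : aut) : aut :=
  @Aut (aut_inv g) g (@aut_invK g) (@aut_funK g) (@autV_linear g)
    (@autV_form g).

HB.instance Definition _ := gen_eqMixin aut.
HB.instance Definition _ := gen_choiceMixin aut.

Lemma autMA : associative autM. Proof. by move=> *; exact: aut_eq. Qed.
Lemma aut1M : left_id aut1 autM. Proof. by move=> *; exact: aut_eq. Qed.
Lemma autM1 : right_id aut1 autM. Proof. by move=> *; exact: aut_eq. Qed.
Lemma autVM : left_inverse aut1 autV autM.
Proof. by move=> g; apply: aut_eq => x; exact: aut_funK. Qed.
Lemma autMV : right_inverse aut1 autV autM.
Proof. by move=> g; apply: aut_eq => x; exact: aut_invK. Qed.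

HB.instance Definition _ := isGroup.Build aut autMA aut1M autM1 autVM autMV.

End AutomorphismGroup.

Section StandardSpaces.
Variable F : fieldType.

Definition stdSpace (m n : nat) : Type := ('rV[F]_m * 'rV[F]_m * 'rV[F]_n)%type.
HB.instance Definition _ m n := GRing.Lmodule.on (stdSpace m n).

Definition std_form m n (u v : stdSpace m n) : F :=
  \sum_(i < m) (u.1.1 0 i * v.1.2 0 i - u.1.2 0 i * v.1.1 0 i).

Lemma std_form_scalarl m n (v : stdSpace m n) : scalar ((@std_form m n)^~ v).
Proof.
move=> a u w; rewrite /std_form mulr_sumr -big_split /=.
by apply: eq_bigr => i _; rewrite !mxE; ring.
Qed.

Lemma std_form_scalarr m n (v : stdSpace m n) : scalar (@std_form m n v).
Proof.
move=> a u w; rewrite /std_form mulr_sumr -big_split /=.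
by apply: eq_bigr => i _; rewrite !mxE; ring.
Qed.

Lemma std_form_alternating m n (v : stdSpace m n) : std_form v v = 0.
Proof. by rewrite /std_form big1 // => i _; ring. Qed.

HB.instance Definition _ m n := Lmodule_hasAltForm.Build F (stdSpace m n)
  (@std_form_scalarl m n) (@std_form_scalarr m n) (@std_form_alternating m n).

(* The free module on nat + nat; <<inl i>> and <<inr i>> are e_(i+1) and
   f_(i+1). *)
Definition infSpace : Type := {malg F[(nat + nat)%type]}.
HB.instance Definition _ := GRing.Lmodule.on infSpace.

Definition e_ (i : nat) : infSpace := << inl i >>.
Definition f_ (i : nat) : infSpace := << inr i >>.

Definition inf_index (k : nat + nat) : nat :=
  match k with inl i | inr i => i end.

Definition inf_term (u v : infSpace) (i : nat) : F :=
  u@_(inl i) * v@_(inr i) - u@_(inr i) * v@_(inl i).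

(* All the other terms vanish, see inf_formE. *)
Definition inf_form (u v : infSpace) : F :=
  \sum_(i <- [fset inf_index k | k in msupp u]%fset) inf_term u v i.

Lemma inf_formE (d : {fset nat}) (u v : infSpace) :
  ([fset inf_index k | k in msupp u] `<=` d)%fset ->
  inf_form u v = \sum_(i <- d) inf_term u v i.
Proof.
move=> ud; rewrite /inf_form (big_fset_incl _ ud) // => i _ iu.
have u0 k : inf_index k = i -> u@_k = 0.
  move=> ki; apply/eqP; rewrite mcoeff_eq0; apply: contra iu => ku.
  by rewrite -ki; apply: in_imfset.
by rewrite /inf_term !u0 // !mul0r subr0.
Qed.

Lemma inf_form_scalarl (v : infSpace) : scalar (inf_form^~ v).
Proof.
move=> a u w.
pose s (x : infSpace) := [fset inf_index k | k in msupp x]%fset.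
pose d := (s (a *: u + w)%R `|` (s u `|` s w))%fset.
have du : (s u `<=` d)%fset by rewrite fsubsetU // fsubsetUl orbT.
have dw : (s w `<=` d)%fset by rewrite fsubsetU // fsubsetUr orbT.
rewrite (inf_formE v du) (inf_formE v dw) (@inf_formE d) ?fsubsetUl //.
rewrite mulr_sumr -big_split /=; apply: eq_bigr => i _.
by rewrite /inf_term !mcoeffD !mcoeffZ; ring.
Qed.

Lemma inf_form_scalarr (u : infSpace) : scalar (inf_form u).
Proof.
move=> a v w; rewrite /inf_form mulr_sumr -big_split /=.
by apply: eq_bigr => i _; rewrite /inf_term !mcoeffD !mcoeffZ; ring.
Qed.

Lemma inf_form_alternating (v : infSpace) : inf_form v v = 0.
Proof. by rewrite /inf_form big1 // => i _; rewrite /inf_term; ring. Qed.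

HB.instance Definition _ := Lmodule_hasAltForm.Build F infSpace
  inf_form_scalarl inf_form_scalarr inf_form_alternating.

Lemma altform_basis (i j : nat) :
  [/\ altform (e_ i) (e_ j) = 0, altform (f_ i) (f_ j) = 0
    & altform (e_ i) (f_ j) = (i == j)%:R].
Proof.
have sl (k : nat + nat) : [fset inf_index l | l in msupp (<< k >> : infSpace)]%fset
    = [fset inf_index k]%fset.
  apply/fsetP => l; rewrite msuppU oner_eq0 in_fset1.
  by apply/imfsetP/eqP => [[x /= + ->]|->]; [rewrite inE => /eqP-> | exists k; rewrite //= inE].
split; rewrite /altform /= /e_ /f_ /inf_form sl big_seq_fset1 /inf_term !mcoeffU.
- by rewrite mulr0 mul0r subr0.
- by rewrite mul0r mulr0 subr0.
- by rewrite !eqE /= eqn_leq leqnn /= mul1r mul0r subr0 eqn_leq andbC -eqn_leq.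
Qed.

End StandardSpaces.

HB.instance Definition _ (F : finFieldType) m n := Finite.on (stdSpace F m n).

Definition equivariant (G X Y : Type) (aX : G -> X -> X) (aY : G -> Y -> Y)
    (f : X -> Y) : Prop :=
  forall g x, f (aX g x) = aY g (f x).

Section SmoothSets.
Variable F : finFieldType.

Local Notation V := (infSpace F).
Local Notation G := (aut V).

(* A transitive V-smooth G-set is isomorphic to an orbit of G on V ^ k, hence is
   countable and has an isomorphic copy with carrier in [Set]. Bounding the size
   of the carriers makes the generators of Theta a small type. The sets X_{m,n}
   themselves are not in [Set], as [F] lives in a larger universe, so they are
   referred to up to isomorphism below. *)
Record smoothSet := SmoothSet {
  carrier :> Set;
  act : G -> carrier -> carrier;
  act1 : forall x, act 1%g x = x;
  actM : forall g h x, act (g * h)%g x = act g (act h x);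
  act_inhabited : exists x : carrier, True;
  act_transitive : forall x y, exists g, act g x = y;
  act_smooth : forall x, exists A : {fset V},
    forall g, act g x = x <-> {in A, forall v, g v = v}
}.

Record smoothMap (Y X : smoothSet) := SmoothMap {
  smap :> Y -> X;
  smapP : equivariant (@act Y) (@act X) smap
}.

Lemma smap_comp_subproof (Z Y X : smoothSet) (f : smoothMap Y X)
  (g : smoothMap Z Y) : equivariant (@act Z) (@act X) (f \o g).
Proof. by move=> a z /=; rewrite !smapP. Qed.

Definition smap_comp (Z Y X : smoothSet) (f : smoothMap Y X)
    (g : smoothMap Z Y) : smoothMap Z X :=
  SmoothMap (smap_comp_subproof f g).

Lemma pt_smooth (x : unit) : exists A : {fset V},
  forall g : G, x = x <-> {in A, forall v, g v = v}.
Proof. by exists fset0 => g; split. Qed.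

Definition pt : smoothSet :=
  @SmoothSet unit (fun _ x => x) (fun=> erefl) (fun _ _ _ => erefl)
    (ex_intro _ tt I) (fun 'tt 'tt => ex_intro _ 1%g erefl) pt_smooth.

Definition to_pt (X : smoothSet) : smoothMap X pt :=
  @SmoothMap X pt (fun=> tt) (fun _ _ => erefl).

(* The maps (p i, f' i) identify the disjoint union of the Y' i with the fibre
   product of f : Y -> X and h : X' -> X; as each Y' i is transitive, this is
   the orbit decomposition. *)
Definition fibre_product_orbits (Y X X' : smoothSet) (f : smoothMap Y X)
    (h : smoothMap X' X) (n : nat) (Y' : 'I_n -> smoothSet)
    (p : forall i, smoothMap (Y' i) Y) (f' : forall i, smoothMap (Y' i) X') :
    Prop :=
  (forall i y', f (p i y') = h (f' i y')) /\
  (forall y x', f y = h x' ->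
     exists! s : {i : 'I_n & Y' i},
       p (tag s) (tagged s) = y /\ f' (tag s) (tagged s) = x').

Inductive theta_term : Type :=
| Tsym (Y X : smoothSet) (f : smoothMap Y X)
| Tzero
| Tone
| Topp (s : theta_term)
| Tadd (s t : theta_term)
| Tmul (s t : theta_term).

Inductive theta_rel : theta_term -> theta_term -> Prop :=
| Trefl s : theta_rel s s
| Tsymm s t : theta_rel s t -> theta_rel t s
| Ttrans s t u : theta_rel s t -> theta_rel t u -> theta_rel s u
| Topp_congr s s' : theta_rel s s' -> theta_rel (Topp s) (Topp s')
| Tadd_congr s s' t t' :
    theta_rel s s' -> theta_rel t t' -> theta_rel (Tadd s t) (Tadd s' t')
| Tmul_congr s s' t t' :
    theta_rel s s' -> theta_rel t t' -> theta_rel (Tmul s t) (Tmul s' t')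
| TaddA s t u : theta_rel (Tadd s (Tadd t u)) (Tadd (Tadd s t) u)
| TaddC s t : theta_rel (Tadd s t) (Tadd t s)
| Tadd0 s : theta_rel (Tadd Tzero s) s
| TaddN s : theta_rel (Tadd (Topp s) s) Tzero
| TmulA s t u : theta_rel (Tmul s (Tmul t u)) (Tmul (Tmul s t) u)
| TmulC s t : theta_rel (Tmul s t) (Tmul t s)
| Tmul1 s : theta_rel (Tmul Tone s) s
| TmulD s t u :
    theta_rel (Tmul (Tadd s t) u) (Tadd (Tmul s u) (Tmul t u))
| Tsym_iso Y X (f : smoothMap Y X) : bijective f -> theta_rel (Tsym f) Tone
| Tsym_comp Z Y X (f : smoothMap Y X) (g : smoothMap Z Y) :
    theta_rel (Tsym (smap_comp f g)) (Tmul (Tsym f) (Tsym g))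
| Tsym_base Y X X' (f : smoothMap Y X) (h : smoothMap X' X) n
    (Y' : 'I_n -> smoothSet) (p : forall i, smoothMap (Y' i) Y)
    (f' : forall i, smoothMap (Y' i) X') :
    fibre_product_orbits f h p f' ->
    theta_rel (Tsym f) (\big[Tadd/Tzero]_(i < n) Tsym (f' i)).

Definition theta_eq (s t : {classic theta_term}) : bool := `[< theta_rel s t >].

Lemma theta_eq_refl : reflexive theta_eq.
Proof. by move=> s; apply/asboolP; exact: Trefl. Qed.

Lemma theta_eq_sym : symmetric theta_eq.
Proof. by move=> s t; apply/asboolP/asboolP; exact: Tsymm. Qed.

Lemma theta_eq_trans : transitive theta_eq.
Proof.
by move=> t s u /asboolP st /asboolP tu; apply/asboolP; exact: Ttrans st tu.
Qed.

Canonical theta_equiv :=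
  EquivRel theta_eq theta_eq_refl theta_eq_sym theta_eq_trans.

Definition Theta : Type := {eq_quot theta_eq}.
HB.instance Definition _ := Choice.on Theta.
HB.instance Definition _ := EqQuotient.on Theta.

Definition theta_cl (s : theta_term) : Theta := \pi_Theta (s : {classic theta_term}).

Lemma theta_clP (s t : theta_term) : theta_cl s = theta_cl t <-> theta_rel s t.
Proof. by split => [/eqmodP/asboolP|st]; last apply/eqmodP/asboolP. Qed.

Definition theta_repr (x : Theta) : theta_term := repr x.

Lemma theta_reprK (x : Theta) : theta_cl (theta_repr x) = x.
Proof. exact: reprK. Qed.

Lemma theta_clK (s : theta_term) : theta_rel (theta_repr (theta_cl s)) s.
Proof. by apply/theta_clP; rewrite theta_reprK. Qed.

Lemma theta_ind (P : Theta -> Prop) : (forall s, P (theta_cl s)) -> forall x, P x.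
Proof. by move=> Ps x; rewrite -[x]theta_reprK. Qed.

Definition theta_zero := theta_cl Tzero.
Definition theta_one := theta_cl Tone.
Definition theta_opp x := theta_cl (Topp (theta_repr x)).
Definition theta_add x y := theta_cl (Tadd (theta_repr x) (theta_repr y)).
Definition theta_mul x y := theta_cl (Tmul (theta_repr x) (theta_repr y)).

Lemma theta_oppE s : theta_opp (theta_cl s) = theta_cl (Topp s).
Proof. by apply/theta_clP/Topp_congr/theta_clK. Qed.

Lemma theta_addE s t : theta_add (theta_cl s) (theta_cl t) = theta_cl (Tadd s t).
Proof. by apply/theta_clP/Tadd_congr; exact: theta_clK. Qed.

Lemma theta_mulE s t : theta_mul (theta_cl s) (theta_cl t) = theta_cl (Tmul s t).
Proof. by apply/theta_clP/Tmul_congr; exact: theta_clK. Qed.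

Let thetaE := (theta_oppE, theta_addE, theta_mulE).

Lemma theta_addA : associative theta_add.
Proof.
elim/theta_ind => s; elim/theta_ind => t; elim/theta_ind => u.
by rewrite !thetaE; apply/theta_clP/TaddA.
Qed.

Lemma theta_addC : commutative theta_add.
Proof.
elim/theta_ind => s; elim/theta_ind => t.
by rewrite !thetaE; apply/theta_clP/TaddC.
Qed.

Lemma theta_add0 : left_id theta_zero theta_add.
Proof. by elim/theta_ind => s; rewrite !thetaE; apply/theta_clP/Tadd0. Qed.

Lemma theta_addN : left_inverse theta_zero theta_opp theta_add.
Proof. by elim/theta_ind => s; rewrite !thetaE; apply/theta_clP/TaddN. Qed.

Lemma theta_mulA : associative theta_mul.
Proof.
elim/theta_ind => s; elim/theta_ind => t; elim/theta_ind => u.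
by rewrite !thetaE; apply/theta_clP/TmulA.
Qed.

Lemma theta_mulC : commutative theta_mul.
Proof.
elim/theta_ind => s; elim/theta_ind => t.
by rewrite !thetaE; apply/theta_clP/TmulC.
Qed.

Lemma theta_mul1 : left_id theta_one theta_mul.
Proof. by elim/theta_ind => s; rewrite !thetaE; apply/theta_clP/Tmul1. Qed.

Lemma theta_mulD : left_distributive theta_mul theta_add.
Proof.
elim/theta_ind => s; elim/theta_ind => t; elim/theta_ind => u.
by rewrite !thetaE; apply/theta_clP/TmulD.
Qed.

HB.instance Definition _ := GRing.isZmodule.Build Theta
  theta_addA theta_addC theta_add0 theta_addN.
HB.instance Definition _ := GRing.Zmodule_isComPzRing.Build Theta
  theta_mulA theta_mulC theta_mul1 theta_mulD.

Definition symb (Y X : smoothSet) (f : smoothMap Y X) : Theta :=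
  theta_cl (Tsym f).

End SmoothSets.

Notation "[ 'symb' f ]" := (symb f) (format "[ 'symb'  f ]") : ring_scope.

Section Localization.
Variables (n : nat) (A : comPzRingType).

(* (x, i) stands for x / n ^ i. *)
Definition loc_eq (u v : A * nat) : bool :=
  `[< exists k, u.1 *+ n ^ (k + v.2) = v.1 *+ n ^ (k + u.2) >].

Lemma loc_eq_refl : reflexive loc_eq.
Proof. by move=> u; apply/asboolP; exists 0. Qed.

Lemma loc_eq_sym : symmetric loc_eq.
Proof. by move=> u v; apply/asboolP/asboolP => -[k uv]; exists k. Qed.

Lemma loc_eq_trans : transitive loc_eq.
Proof.
move=> v u w /asboolP[k uv] /asboolP[l vw]; apply/asboolP.
exists (k + l + v.2)%N.
have -> : (k + l + v.2 + w.2 = (k + v.2) + (l + w.2))%N by lia.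
rewrite expnD mulrnA uv -mulrnA mulnC mulrnA vw -mulrnA -expnD.
by congr (_ *+ _ ^ _); lia.
Qed.

Canonical loc_equiv := EquivRel loc_eq loc_eq_refl loc_eq_sym loc_eq_trans.

Definition loc : Type := {eq_quot loc_eq}.
HB.instance Definition _ := Choice.on loc.
HB.instance Definition _ := EqQuotient.on loc.

Definition loc_frac (x : A) (i : nat) : loc := \pi_loc (x, i).

Lemma loc_fracP x i y j :
  loc_frac x i = loc_frac y j <-> exists k, x *+ n ^ (k + j) = y *+ n ^ (k + i).
Proof. by split => [/eqmodP/asboolP|xy]; last apply/eqmodP/asboolP. Qed.

Lemma loc_ind (P : loc -> Prop) : (forall x i, P (loc_frac x i)) -> forall u, P u.
Proof. by move=> Px u; rewrite -[u]reprK; case: (repr u) => x i; exact: Px. Qed.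

Lemma loc_reprP x i (u := repr (loc_frac x i)) :
  exists k, u.1 *+ n ^ (k + i) = x *+ n ^ (k + u.2).
Proof.
by apply/loc_fracP; rewrite /u /loc_frac -[RHS]reprK; case: (repr _).
Qed.

Let exp_mono (x y : A) a b c :
  x *+ n ^ a = y *+ n ^ b -> x *+ n ^ (a + c) = y *+ n ^ (b + c).
Proof. by move=> xy; rewrite !expnD !mulrnA xy. Qed.

Definition loc_zero : loc := loc_frac 0 0.
Definition loc_one : loc := loc_frac 1 0.
Definition loc_opp (u : loc) : loc := loc_frac (- (repr u).1) (repr u).2.
Definition loc_add (u v : loc) : loc :=
  loc_frac ((repr u).1 *+ n ^ (repr v).2 + (repr v).1 *+ n ^ (repr u).2)
    ((repr u).2 + (repr v).2).
Definition loc_mul (u v : loc) : loc :=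
  loc_frac ((repr u).1 * (repr v).1) ((repr u).2 + (repr v).2).

Lemma loc_oppE x i : loc_opp (loc_frac x i) = loc_frac (- x) i.
Proof.
have [k xk] := loc_reprP x i; apply/loc_fracP; exists k.
by rewrite !mulNrn xk.
Qed.

Lemma loc_addE x i y j :
  loc_add (loc_frac x i) (loc_frac y j) =
  loc_frac (x *+ n ^ j + y *+ n ^ i) (i + j).
Proof.
have [k xk] := loc_reprP x i; have [l yl] := loc_reprP y j.
rewrite /loc_add; move: (repr _) (repr _) xk yl => [y' j'] [x' i'] /= xk yl.
apply/loc_fracP; exists (k + l)%N.
rewrite !mulrnDl -!mulrnA -!expnD; congr (_ + _).
- have -> : (j' + (k + l + (i + j)) = (k + i) + (j' + l + j))%N by lia.
  have -> : (j + (k + l + (i' + j')) = (k + i') + (j' + l + j))%N by lia.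
  exact: exp_mono.
- have -> : (i' + (k + l + (i + j)) = (l + j) + (i' + k + i))%N by lia.
  have -> : (i + (k + l + (i' + j')) = (l + j') + (i' + k + i))%N by lia.
  exact: exp_mono.
Qed.

Lemma loc_mulE x i y j :
  loc_mul (loc_frac x i) (loc_frac y j) = loc_frac (x * y) (i + j).
Proof.
have [k xk] := loc_reprP x i; have [l yl] := loc_reprP y j.
rewrite /loc_mul; move: (repr _) (repr _) xk yl => [y' j'] [x' i'] /= xk yl.
apply/loc_fracP; exists (k + l)%N.
have -> : (k + l + (i + j) = (k + i) + (l + j))%N by lia.
have -> : (k + l + (i' + j') = (k + i') + (l + j'))%N by lia.
have mulE (s t : A) a b : s * t *+ a *+ b = (s *+ a) * (t *+ b).
  by rewrite mulrnAr mulrnAl.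
by rewrite expnD (expnD n (k + i')) !mulrnA !mulE xk yl.
Qed.

Let locE := (loc_oppE, loc_addE, loc_mulE).

Let loc_frac_eq x y i j : x *+ n ^ j = y *+ n ^ i -> loc_frac x i = loc_frac y j.
Proof. by move=> xy; apply/loc_fracP; exists 0. Qed.

Lemma loc_addA : associative loc_add.
Proof.
elim/loc_ind => x i; elim/loc_ind => y j; elim/loc_ind => z k.
rewrite !locE; apply: loc_frac_eq.
rewrite !mulrnDl -!mulrnA -!expnD -!addrA.
by congr (_ *+ _ ^ _ + (_ *+ _ ^ _ + _ *+ _ ^ _)); lia.
Qed.

Lemma loc_addC : commutative loc_add.
Proof.
by elim/loc_ind => x i; elim/loc_ind => y j; rewrite !locE addrC addnC.
Qed.

Lemma loc_add0 : left_id loc_zero loc_add.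
Proof. by elim/loc_ind => x i; rewrite !locE mul0rn add0r mulr1n. Qed.

Lemma loc_addN : left_inverse loc_zero loc_opp loc_add.
Proof.
elim/loc_ind => x i; rewrite !locE; apply: loc_frac_eq.
by rewrite mulNrn addNr !mul0rn.
Qed.

Lemma loc_mulA : associative loc_mul.
Proof.
elim/loc_ind => x i; elim/loc_ind => y j; elim/loc_ind => z k.
by rewrite !locE mulrA addnA.
Qed.

Lemma loc_mulC : commutative loc_mul.
Proof.
by elim/loc_ind => x i; elim/loc_ind => y j; rewrite !locE mulrC addnC.
Qed.

Lemma loc_mul1 : left_id loc_one loc_mul.
Proof. by elim/loc_ind => x i; rewrite !locE mul1r. Qed.

Lemma loc_mulD : left_distributive loc_mul loc_add.
Proof.
elim/loc_ind => x i; elim/loc_ind => y j; elim/loc_ind => z k.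
rewrite !locE; apply: loc_frac_eq.
rewrite mulrDl !mulrnDl !mulrnAl -!mulrnA -!expnD.
by congr (_ *+ _ ^ _ + _ *+ _ ^ _); lia.
Qed.

HB.instance Definition _ := GRing.isZmodule.Build loc
  loc_addA loc_addC loc_add0 loc_addN.
HB.instance Definition _ := GRing.Zmodule_isComPzRing.Build loc
  loc_mulA loc_mulC loc_mul1 loc_mulD.

Lemma loc_fracD x i y j :
  loc_frac x i + loc_frac y j = loc_frac (x *+ n ^ j + y *+ n ^ i) (i + j).
Proof. exact: loc_addE. Qed.

Lemma loc_fracN x i : - loc_frac x i = loc_frac (- x) i.
Proof. exact: loc_oppE. Qed.

Lemma loc_fracM x i y j : loc_frac x i * loc_frac y j = loc_frac (x * y) (i + j).
Proof. exact: loc_mulE. Qed.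

End Localization.

Section LocalizationMap.
Variables (n : nat) (A B : comPzRingType) (f : {rmorphism A -> B}).

Definition loc_map (u : loc n A) : loc n B := loc_frac n (f (repr u).1) (repr u).2.

Lemma loc_mapE x i : loc_map (loc_frac n x i) = loc_frac n (f x) i.
Proof.
have [k xk] := loc_reprP n x i; apply/loc_fracP; exists k.
by rewrite -[LHS]rmorphMn xk rmorphMn.
Qed.

Lemma loc_map_additive : zmod_morphism loc_map.
Proof.
elim/loc_ind => x i; elim/loc_ind => y j.
by rewrite loc_fracN loc_fracD !loc_mapE loc_fracN loc_fracD rmorphD !rmorphMn rmorphN.
Qed.

Lemma loc_map_multiplicative : monoid_morphism loc_map.
Proof.
split; first by rewrite [LHS]loc_mapE rmorph1.
elim/loc_ind => x i; elim/loc_ind => y j.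
by rewrite loc_fracM !loc_mapE loc_fracM rmorphM.
Qed.

HB.instance Definition _ :=
  GRing.isZmodMorphism.Build (loc n A) (loc n B) loc_map loc_map_additive.
HB.instance Definition _ :=
  GRing.isMonoidMorphism.Build (loc n A) (loc n B) loc_map loc_map_multiplicative.

End LocalizationMap.

Arguments loc_map n {A B} f u.

Section Zinv.
Variable n : nat.

Definition Zinv_pred : {pred rat} :=
  [pred x : rat | `[< exists k, x * n%:R ^+ k \is a Num.int >]].

Lemma Zinv_subring : subring_closed Zinv_pred.
Proof.
split=> [|x y /asboolP[k xk] /asboolP[l yl]|x y /asboolP[k xk] /asboolP[l yl]].
- by apply/asboolP; exists 0; rewrite mulr1.
- apply/asboolP; exists (k + l)%N.
  have -> : (x - y) * n%:R ^+ (k + l)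
    = x * n%:R ^+ k * n%:R ^+ l - y * n%:R ^+ l * n%:R ^+ k.
    by rewrite exprD; ring.
  by apply: rpredB; apply: rpredM => //; apply: rpredX; apply: rpred_nat.
- apply/asboolP; exists (k + l)%N.
  have -> : x * y * n%:R ^+ (k + l) = x * n%:R ^+ k * (y * n%:R ^+ l).
    by rewrite exprD; ring.
  exact: rpredM.
Qed.

HB.instance Definition _ := GRing.isSubringClosed.Build rat Zinv_pred Zinv_subring.

Definition Zinv : Type := {x : rat | x \in Zinv_pred}.
HB.instance Definition _ := [isSub of Zinv for @sval rat (fun x => x \in Zinv_pred)].
HB.instance Definition _ := [Choice of Zinv by <:].
HB.instance Definition _ := [SubChoice_isSubComNzRing of Zinv by <:].

End Zinv.

Section Counting.
Variable F : finFieldType.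

Local Notation q := #|F|.
Local Notation V := (infSpace F).
Local Notation V_ m n := (stdSpace F m n).
Local Notation Zq := (Zinv q).

Definition X_ (m n : nat) : Type := embedding (V_ m n) V.

Definition X_act m n (g : aut V) (x : X_ m n) : X_ m n :=
  Embedding (is_embedding_comp (aut_embedding g) (embP x)).

Definition smooth_iso (X : smoothSet F) m n (h : X -> X_ m n) : Prop :=
  bijective h /\ equivariant (@act F X) (@X_act m n) h.

Definition restriction m n m' n' (j : embedding (V_ m n) (V_ m' n'))
    (x : X_ m' n') : X_ m n :=
  Embedding (is_embedding_comp (embP x) (embP j)).

Definition num_embeddings (a b m : nat) : nat :=
  #|[set h : {ffun V_ a b -> V_ m 0} | `[< is_embedding h >]]|.

Definition num_extensions a b a' b' m (j : embedding (V_ a b) (V_ a' b'))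
    (i : embedding (V_ a b) (V_ m 0)) : nat :=
  #|[set h : {ffun V_ a' b' -> V_ m 0} |
     `[< is_embedding h /\ forall v, h (j v) = i v >]]|.

Definition is_embedding_poly a b (P : {poly Zq}) : Prop :=
  forall m, P.[q%:R ^+ (2 * m)] = (num_embeddings a b m)%:R.

(* P takes the value nu_m(f) at q ^ 2m for all large m, where f is the
   restriction along j. *)
Definition is_extension_poly a b a' b' (j : embedding (V_ a b) (V_ a' b'))
    (P : {poly Zq}) : Prop :=
  exists M, forall m, (M <= m)%N -> forall i : embedding (V_ a b) (V_ m 0),
    P.[q%:R ^+ (2 * m)] = (num_extensions j i)%:R.

(* Every map of transitive V-smooth G-sets is, up to isomorphism, a restriction
   map; so this determines phi on all the generators. *)
Definition counting_hom (phi : Theta F -> {poly Zq}) : Prop :=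
  (forall a b (X : smoothSet F) (h : X -> X_ a b),
     smooth_iso h -> is_embedding_poly a b (phi [symb to_pt X])) /\
  (forall a b a' b' (j : embedding (V_ a b) (V_ a' b'))
     (Y X : smoothSet F) (f : smoothMap Y X)
     (hX : X -> X_ a b) (hY : Y -> X_ a' b'),
     smooth_iso hX -> smooth_iso hY ->
     (forall y, hX (f y) = restriction j (hY y)) ->
     is_extension_poly j (phi [symb f])).

End Counting.

(* Main.v *)
(** Let [V_m] be the span of [e_i], [f_i] for [i < m]. Taking the fixed points of
    the pointwise stabilizer of [V_m] turns a smooth [G]-set [X] into a finite set
    and commutes with fibre products and with disjoint unions. Hence, for
    [f : Y -> X], the cardinality of the fibres on fixed points respects the
    relations of [Theta] as soon as it is a polynomial in [q ^ 2m]. Every map is,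
    up to isomorphisms, a composite of maps [O(v :: s) -> O(s)] of orbits of
    independent sequences, and by Witt's theorem for one additional vector the
    count for such a map is [q ^ (2m - d) - c], where [d = size s] and [c] is
    independent of [m].

    For the bijectivity, let [tau] be the class of the set of nonzero vectors. The
    base change of [O(v :: s) -> O(s)] along [O(r) -> O(s)], where [r] is a basis
    of a nondegenerate space containing [s], consists of isomorphisms, for the
    vectors in the span of [r], and of maps isomorphic to [O(z :: r) -> O(r)] with
    [z] orthogonal to [r]. The case [s = [::]] shows that [q ^ size r] times the
    class of the latter is [tau] minus an integer, so that, up to powers of [q],
    every class is an integral polynomial in [tau]; and [phi tau] is ['X] minus an
    integer. *)

From HB Require Import structures.
Require Import Defs.
From mathcomp Require Import all_boot all_order all_algebra.
From mathcomp Require Import finmap.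
From mathcomp Require Import boolp.
From mathcomp.multinomials Require Import monalg.
From mathcomp Require Import ring zify.

Set Implicit Arguments.
Unset Strict Implicit.
Unset Printing Implicit Defensive.

Import GRing.Theory Num.Theory.
Local Open Scope ring_scope.

Section AlternatingForms.
Variables (K : fieldType) (W : altSpaceType K).
Implicit Types (u v w x y z : W) (a c : K) (s t : seq W).

Lemma altformDl u v w : altform (u + v) w = altform u w + altform v w.
Proof. by rewrite -[u]scale1r (altform_scalarl w 1) mul1r scale1r. Qed.

Lemma altformDr u v w : altform w (u + v) = altform w u + altform w v.
Proof. by rewrite -[u]scale1r (altform_scalarr w 1) mul1r scale1r. Qed.

Lemma altform0l w : altform 0 w = 0.
Proof. by apply: (addrI (altform 0 w)); rewrite -altformDl !addr0. Qed.

Lemma altform0r w : altform w 0 = 0.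
Proof. by apply: (addrI (altform w 0)); rewrite -altformDr !addr0. Qed.

Lemma altformZl a u w : altform (a *: u) w = a * altform u w.
Proof. by rewrite -[a *: u]addr0 (altform_scalarl w) altform0l addr0. Qed.

Lemma altformZr a u w : altform w (a *: u) = a * altform w u.
Proof. by rewrite -[a *: u]addr0 (altform_scalarr w) altform0r addr0. Qed.

Lemma altformNl u w : altform (- u) w = - altform u w.
Proof. by rewrite -scaleN1r altformZl mulN1r. Qed.

Lemma altformNr u w : altform w (- u) = - altform w u.
Proof. by rewrite -scaleN1r altformZr mulN1r. Qed.

Definition altformE :=
  (altformDl, altformDr, altformZl, altformZr, altformNl, altformNr,
   altform0l, altform0r).

Lemma altformC u v : altform u v = - altform v u.
Proof.
have := altform_alternating (u + v); rewrite !altformE !altform_alternating.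
by rewrite addr0 add0r => /eqP; rewrite addr_eq0 => /eqP.
Qed.

Lemma altform_suml (I : Type) (r : seq I) (f : I -> W) w :
  altform (\sum_(i <- r) f i) w = \sum_(i <- r) altform (f i) w.
Proof. by elim/big_rec2: _ => [|i a u _ <-]; rewrite altformE. Qed.

Lemma altform_sumr (I : Type) (r : seq I) (f : I -> W) w :
  altform w (\sum_(i <- r) f i) = \sum_(i <- r) altform w (f i).
Proof. by elim/big_rec2: _ => [|i a u _ <-]; rewrite altformE. Qed.

Definition pairs s v : seq K := [seq altform u v | u <- s].

Lemma size_pairs s v : size (pairs s v) = size s.
Proof. exact: size_map. Qed.

Lemma pairs_inP s v w :
  pairs s v = pairs s w <-> {in s, forall u, altform u v = altform u w}.
Proof. by split=> [/eq_in_map|/eq_in_map]. Qed.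

Fixpoint span_of s x : Prop :=
  match s with
  | [::] => x = 0
  | u :: s' => exists c, span_of s' (x - c *: u)
  end.

Fixpoint lincomb s (b : seq K) : W :=
  match s, b with
  | u :: s', c :: b' => c *: u + lincomb s' b'
  | _, _ => 0
  end.

Fixpoint independent s : Prop :=
  match s with
  | [::] => True
  | u :: s' => ~ span_of s' u /\ independent s'
  end.

Lemma span_ofP s x :
  span_of s x <-> exists2 b : (size s).-tuple K, lincomb s b = x & True.
Proof.
elim: s x => [|u s IH] x /=.
  by split=> [->|[b <-]//]; exists (in_tuple [::]).
split=> [[c /IH[b bx _]]|[b <- _]].
  by exists [tuple of c :: b]; rewrite //= bx addrC subrK.
exists (thead b); apply/IH; exists (behead_tuple b) => //.
by case/tupleP: b => c b /=; rewrite theadE addrAC subrr add0r.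
Qed.

Lemma span_ofD s x y : span_of s x -> span_of s y -> span_of s (x + y).
Proof.
elim: s x y => [x y -> ->|u s IH x y [c sx] [d sy]] /=; first by rewrite addr0.
by exists (c + d); rewrite scalerDl opprD addrACA; apply: IH.
Qed.

Lemma span_ofZ s a x : span_of s x -> span_of s (a *: x).
Proof.
elim: s x => [x ->|u s IH x [c sx]] /=; first by rewrite scaler0.
by exists (a * c); rewrite -scalerA -scalerBr; apply: IH.
Qed.

Lemma span_ofB s x y : span_of s x -> span_of s y -> span_of s (x - y).
Proof. by move=> sx sy; rewrite -scaleN1r; apply/span_ofD/span_ofZ. Qed.

Lemma span_of0 s : span_of s 0.
Proof. by elim: s => //= u s IH; exists 0; rewrite scale0r subr0. Qed.

Lemma span_of_behead u s x : span_of s x -> span_of (u :: s) x.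
Proof. by exists 0; rewrite scale0r subr0. Qed.

Lemma mem_span_of s x : x \in s -> span_of s x.
Proof.
elim: s => [|u s IH] /=; rewrite ?in_nil // inE => /predU1P[->|/IH xs];
  last exact: span_of_behead.
by exists 1; rewrite scale1r subrr; apply: span_of0.
Qed.

Lemma span_of_closed (P : W -> Prop) s :
  P 0 -> (forall c u v, P u -> P v -> P (c *: u + v)) ->
  {in s, forall u, P u} -> forall x, span_of s x -> P x.
Proof.
move=> P0 Pl; elim: s => [_ x ->//|u s IH /= Ps x [c sx]].
rewrite -[x](subrK (c *: u)) addrC; apply: Pl.
  by apply: Ps; rewrite mem_head.
by apply: IH => // v vs; apply: Ps; rewrite inE vs orbT.
Qed.

Lemma sub_span_of s t x : {in s, forall u, span_of t u} -> span_of s x -> span_of t x.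
Proof.
move=> st; apply: span_of_closed st x; first exact: span_of0.
by move=> c u v tu tv; apply/span_ofD/tv/span_ofZ.
Qed.

Lemma lincomb_inj s : independent s ->
  forall b b' : (size s).-tuple K, lincomb s b = lincomb s b' -> b = b'.
Proof.
elim: s => [_ b b' _|u s IH /= [us si] b b']; first by rewrite [b]tuple0 [b']tuple0.
case/tupleP: b => c b; case/tupleP: b' => c' b' /= bb'.
have cc' : c = c'.
  apply/eqP; rewrite -subr_eq0; apply/negPn/negP => d0; apply: us.
  have -> : u = (c - c')^-1 *: (lincomb s b' - lincomb s b).
    have -> : lincomb s b' - lincomb s b = (c - c') *: u.
      have -> : lincomb s b' = c *: u + lincomb s b - c' *: u.
        by rewrite bb' addrAC subrr add0r.
      by rewrite addrAC addrK scalerBl.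
    by rewrite scalerA mulVf ?scale1r.
  by apply/span_ofZ/span_ofB; apply/span_ofP; [exists b' | exists b].
rewrite cc' in bb' *; congr [tuple of _ :: _].
exact: IH si _ _ (addrI _ bb').
Qed.

Lemma independent_extend s t : independent s ->
  exists r, independent (r ++ s) /\
    forall x, span_of (r ++ s) x <-> span_of (t ++ s) x.
Proof.
move=> si; elim: t => [|u t [r [ri rE]]]; first by exists [::].
have [ur|ur] := pselect (span_of (r ++ s) u).
  exists r; split=> // x; rewrite rE; split=> [|/=]; first exact: span_of_behead.
  move=> [c tx]; rewrite -[x](subrK (c *: u)).
  by apply: span_ofD => //; apply/span_ofZ/rE.
by exists (u :: r); split=> //= x; split=> -[c]; exists c; apply/rE.
Qed.

Definition nondegenerate : Prop :=
  forall v, v <> 0 -> exists w, altform v w != 0.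

Hypothesis ndW : nondegenerate.

Lemma span_of_perp s x : ~ span_of s x ->
  exists2 y, {in s, forall u, altform u y = 0} & altform x y != 0.
Proof.
elim: s x => [|u s IH] x /=; first by move=> /ndW[y]; exists y.
move=> sx; have [|y1 sy1 xy1] := IH x.
  by move=> sx'; apply: sx; exists 0; rewrite scale0r subr0.
have [uy1|uy1] := eqVneq (altform u y1) 0.
  by exists y1 => // v; rewrite inE => /predU1P[->|/sy1].
pose c := altform x y1 / altform u y1.
have [y2 sy2 xy2] := IH (x - c *: u) (fun sx' => sx (ex_intro _ c sx')).
exists (y2 - (altform u y2 / altform u y1) *: y1) => [v|].
  rewrite inE !altformE => /predU1P[->|vs]; last by rewrite (sy1 v) ?(sy2 v) // mulr0 subr0.
  by rewrite divfK // subrr.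
apply: contra_neq xy2 => xy; rewrite !altformE -[RHS]xy !altformE /c; ring.
Qed.

Lemma pairs_surj s (l : seq K) : independent s -> size l = size s ->
  exists w, pairs s w = l.
Proof.
elim: s l => [|u s IH] [|a l] //=; first by exists 0.
move=> [us /IH IHs] [/IHs[w sw]]; have [y sy uy] := span_of_perp us.
exists (w + ((a - altform u w) / altform u y) *: y).
rewrite !altformE divfK // addrC subrK; congr (_ :: _).
rewrite -sw; apply/eq_in_map => v vs.
by rewrite !altformE (sy v) // mulr0 addr0.
Qed.

Section Transvection.
Variables (z : W) (c : K).

Definition transv (d : K) x : W := x + (d * altform x z) *: z.

Lemma transv_linear d : linear (transv d).
Proof.
move=> a u v; rewrite /transv !altformE mulrDr scalerDl scalerDr scalerA.
rewrite addrACA; congr (_ + _ *: _ + _); ring.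
Qed.

Lemma transvK d : cancel (transv d) (transv (- d)).
Proof.
move=> x; rewrite /transv !altformE altform_alternating mulr0 addr0.
by rewrite mulNr scaleNr addrK.
Qed.

Lemma transvVK d : cancel (transv (- d)) (transv d).
Proof. by move=> x; rewrite -{1}[d]opprK transvK. Qed.

Lemma transv_form d u v : altform (transv d u) (transv d v) = altform u v.
Proof.
rewrite /transv !altformE altform_alternating (altformC z v); ring.
Qed.

Definition transvection : aut W :=
  Aut (transvK c) (transvVK c) (transv_linear c)
    (transv_form c).
End Transvection.

End AlternatingForms.

Section Embeddings.
Variables (K : fieldType) (U W : altSpaceType K) (f : U -> W).
Hypothesis fP : is_embedding f.

Lemma embeddingP c u v : f (c *: u + v) = c *: f u + f v.
Proof. by case: fP => ->. Qed.

Lemma embedding0 : f 0 = 0.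
Proof. by apply: (addrI (f 0)); rewrite -{1}[f 0]scale1r -embeddingP scale1r !addr0. Qed.

Lemma embeddingZ c u : f (c *: u) = c *: f u.
Proof. by rewrite -[c *: u]addr0 embeddingP embedding0 addr0. Qed.

Lemma embeddingD u v : f (u + v) = f u + f v.
Proof. by rewrite -{1}[u]scale1r embeddingP scale1r. Qed.

Lemma embeddingB u v : f (u - v) = f u - f v.
Proof. by rewrite -scaleN1r embeddingD embeddingZ scaleN1r. Qed.

Lemma lincomb_map s b : lincomb (map f s) b = f (lincomb s b).
Proof.
elim: s b => [|u s IH] [|c b] /=; rewrite ?embedding0 //.
by rewrite embeddingD embeddingZ IH.
Qed.

Lemma pairs_map s x : pairs (map f s) (f x) = pairs s x.
Proof. by rewrite /pairs -map_comp; apply: eq_map => u /=; case: fP. Qed.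

Lemma span_of_map s x : span_of (map f s) (f x) <-> span_of s x.
Proof.
have f_inj : injective f by case: fP.
elim: s x => [|u s IH] x /=.
  by split=> [|->]; rewrite ?embedding0 // -[in RHS]embedding0 => /f_inj.
by split=> -[c sx]; exists c; move: sx; rewrite -embeddingZ -embeddingB IH.
Qed.

Lemma independent_map s : independent (map f s) <-> independent s.
Proof. by elim: s => //= u s IH; rewrite IH span_of_map. Qed.

End Embeddings.

Section Witt.
Variables (K : fieldType) (W : altSpaceType K).
Implicit Types (g : aut W) (s t : seq W) (v w x z : W).

Definition aut_mul_appE g h x : (g * h)%g x = g (h x) := erefl.

Definition autP g : is_embedding g := aut_embedding g.

Definition fixes g s : Prop := {in s, forall u, g u = u}.

Lemma fixes_map g s : fixes g s <-> map g s = s.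
Proof.
split=> [gs|gs u us]; first by rewrite -[RHS]map_id; apply/eq_in_map.
by move: gs; rewrite -[in RHS](map_id s) => /eq_in_map; apply.
Qed.

Lemma fixes_cons g u s : fixes g (u :: s) <-> g u = u /\ fixes g s.
Proof.
split=> [gus|[gu gs] v].
  by split=> [|v vs]; apply: gus; rewrite inE ?eqxx // vs orbT.
by rewrite inE => /predU1P[->|/gs].
Qed.

Lemma fixes_cat g s t : fixes g (s ++ t) <-> fixes g s /\ fixes g t.
Proof.
elim: s => [|u s IH]; first by split=> // -[].
by rewrite cat_cons !fixes_cons IH; tauto.
Qed.

Lemma fixes_span g s : fixes g s -> forall x, span_of s x -> g x = x.
Proof.
apply: span_of_closed; first exact: (embedding0 (autP g)).
by move=> c u v gu gv; rewrite (embeddingP (autP g)) gu gv.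
Qed.

Lemma fixesM g h s : fixes g s -> fixes h s -> fixes (g * h)%g s.
Proof. by move=> gs hs u us; rewrite aut_mul_appE hs ?gs. Qed.

Lemma fixes_eq_span s t : (forall x, span_of s x <-> span_of t x) ->
  forall g, fixes g s <-> fixes g t.
Proof.
by move=> st g; split=> gs u us; apply: (fixes_span gs); apply/st/mem_span_of.
Qed.

Lemma fixes_transvection z c s :
  {in s, forall u, altform u z = 0} -> fixes (transvection z c) s.
Proof. by move=> sz u us; rewrite /= /transv sz // mulr0 scale0r addr0. Qed.

Lemma witt_transvection s v w : pairs s v = pairs s w -> altform v w != 0 ->
  exists2 g, fixes g s & g v = w.
Proof.
move=> /pairs_inP vw nz; exists (transvection (w - v) (altform v w)^-1).
  by apply: fixes_transvection => u us; rewrite !altformE vw // subrr.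
rewrite /= /transv !altformE altform_alternating subr0 mulVf //.
by rewrite scale1r addrC subrK.
Qed.

Hypothesis ndW : nondegenerate W.

(* Two proper subspaces of the orthogonal of [s] do not cover it, so some [y]
   there pairs nontrivially with both [v] and [w]; if [v] and [w] are
   orthogonal, go through [v + y]. *)
Lemma witt_step s v w : ~ span_of s v -> ~ span_of s w ->
  pairs s v = pairs s w -> exists2 g, fixes g s & g v = w.
Proof.
move=> sv sw vw; have [vw0|] := eqVneq (altform v w) 0; last first.
  exact: witt_transvection.
have [y [sy vy wy]] : exists y,
    [/\ {in s, forall u, altform u y = 0}, altform v y != 0 & altform w y != 0].
  have [y1 sy1 vy1] := span_of_perp ndW sv.
  have [y2 sy2 wy2] := span_of_perp ndW sw.
  have [wy1|] := eqVneq (altform w y1) 0; last by exists y1.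
  have [vy2|] := eqVneq (altform v y2) 0; last by exists y2.
  exists (y1 + y2); split=> [u us||]; rewrite altformDr ?vy2 ?wy1 ?addr0 ?add0r //.
  by rewrite sy1 // sy2 // addr0.
have [g gs gv] : exists2 g, fixes g s & g v = v + y.
  apply: witt_transvection; last by rewrite altformDr altform_alternating add0r.
  by apply/pairs_inP => u us; rewrite altformDr sy // addr0.
have [h hs hv] : exists2 h, fixes h s & h (v + y) = w.
  apply: witt_transvection; last by rewrite altformDl vw0 add0r altformC oppr_eq0.
  rewrite -vw; apply/pairs_inP => u us; by rewrite altformDr sy // addr0.
by exists (h * g)%g; [exact: fixesM | rewrite aut_mul_appE gv].
Qed.

End Witt.

Section StandardEmbedding.
Variable K : fieldType.
Local Notation V := (infSpace K).
Local Notation V_ m n := (stdSpace K m n).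

Lemma stdSpace_nondegenerate m : nondegenerate (V_ m 0).
Proof.
move=> [[a b] c] abc0.
have [i ab] : exists i, (a 0 i != 0) || (b 0 i != 0).
  apply: contrapT => /forallNP ab; apply: abc0.
  have ab0 i : a 0 i = 0 /\ b 0 i = 0.
    by move: (ab i) => /negP; rewrite negb_or !negbK => /andP[/eqP-> /eqP->].
  congr (_, _, _); last by apply/matrixP => ? [].
  - by apply/rowP => i; rewrite (ab0 i).1 mxE.
  - by apply/rowP => i; rewrite (ab0 i).2 mxE.
have [a0|a0] := eqVneq (a 0 i) 0; move: ab; rewrite ?a0 ?eqxx /= => ab.
- exists (delta_mx 0 i, 0, 0); rewrite /altform /= /std_form (bigD1 i) //= big1.
    by rewrite !mxE !eqxx mulr0 add0r mulr1 addr0 oppr_eq0.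
  by move=> j ji; rewrite !mxE (negPf ji) !mulr0 subr0.
- exists (0, delta_mx 0 i, 0); rewrite /altform /= /std_form (bigD1 i) //= big1.
    by rewrite !mxE !eqxx mulr0 subr0 mulr1 addr0.
  by move=> j ji; rewrite !mxE (negPf ji) !mulr0 subr0.
Qed.


Definition std_emb m (u : V_ m 0) : V :=
  \sum_(i < m) (u.1.1 0 i *: e_ K i + u.1.2 0 i *: f_ K i).

Lemma altform_e_f i j : altform (e_ K i) (f_ K j) = (i == j)%:R.
Proof. by case: (altform_basis K i j). Qed.

Lemma altform_f_e i j : altform (f_ K i) (e_ K j) = - (i == j)%:R.
Proof. by rewrite altformC altform_e_f eq_sym. Qed.

Lemma altform_e_e i j : altform (e_ K i) (e_ K j) = 0.
Proof. by case: (altform_basis K i j). Qed.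

Lemma altform_f_f i j : altform (f_ K i) (f_ K j) = 0.
Proof. by case: (altform_basis K i j). Qed.

Definition altform_basisE := (altform_e_f, altform_f_e, altform_e_e, altform_f_f).

Lemma std_embP m : is_embedding (@std_emb m).
Proof.
have lin : linear (@std_emb m).
  move=> c u v; rewrite /std_emb scaler_sumr -big_split /=.
  apply: eq_bigr => i _; rewrite !mxE !scalerDl !scalerDr !scalerA.
  exact: addrACA.
have form u v : altform (@std_emb m u) (std_emb v) = altform u v.
  rewrite altform_suml; apply: eq_bigr => i _; rewrite altform_sumr.
  rewrite (bigD1 i) //= big1 ?addr0 => [|j ji].
    by rewrite !altformE !altform_basisE !eqxx /= !mulr1n; ring.
  have ij : (i == j :> nat) = false by rewrite eq_sym; apply: negPf.
  by rewrite !altformE !altform_basisE !ij /= mulr0n; ring.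
split=> // u v uv; apply/eqP; rewrite -subr_eq0; apply/eqP.
apply: contrapT => /stdSpace_nondegenerate[w]; rewrite -form addrC -scaleN1r lin.
by rewrite uv scaleN1r addNr altform0l eqxx.
Qed.

Definition in_level m (v : V) : Prop := exists u : V_ m 0, std_emb u = v.

Lemma mcoeff_std_emb m (u : V_ m 0) k : (std_emb u)@_k =
  \sum_(i < m) (u.1.1 0 i * (inl (i : nat) == k)%:R + u.1.2 0 i * (inr (i : nat) == k)%:R).
Proof.
rewrite /std_emb raddf_sum; apply: eq_bigr => i _.
by rewrite /= mcoeffD !mcoeffZ !mcoeffU.
Qed.

Lemma in_levelP m v : in_level m v <-> forall k, (m <= inf_index k)%N -> v@_k = 0.
Proof.
split=> [[u <-] k mk|v0].
  rewrite mcoeff_std_emb big1 // => i _.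
  have i_lt k' : inf_index k' = i -> (k' == k) = false.
    by move=> k'i; apply/eqP => kk'; move: mk (ltn_ord i); rewrite -kk' k'i; lia.
  by rewrite !i_lt // !mulr0 addr0.
exists (\row_i v@_(inl (i : nat)), \row_i v@_(inr (i : nat)), 0).
apply/malgP => k; rewrite mcoeff_std_emb /=.
have [mk|km] := leqP m (inf_index k).
  rewrite v0 // big1 // => i _.
  have i_lt k' : inf_index k' = i -> (k' == k) = false.
    by move=> k'i; apply/eqP => kk'; move: mk (ltn_ord i); rewrite -kk' k'i; lia.
  by rewrite !i_lt // !mulr0 addr0.
rewrite (bigD1 (Ordinal km)) //= big1 ?addr0 => [|j jk].
  by case: k km => k km; rewrite !mxE !eqE /= eqxx mulr1 mulr0 ?addr0 ?add0r.
have j_neq k' : inf_index k' = j -> (k' == k) = false.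
  move=> k'j; apply/eqP => kk'; move: jk; rewrite -kk' in km *.
  by move=> /eqP[]; apply/val_inj; rewrite /= k'j.
by rewrite !j_neq // !mulr0 addr0.
Qed.

Lemma in_level_leq m n v : (m <= n)%N -> in_level m v -> in_level n v.
Proof.
by move=> mn /in_levelP mv; apply/in_levelP => k nk; apply: mv; apply: leq_trans nk.
Qed.

Lemma in_level_ex v : exists m, in_level m v.
Proof.
exists (\max_(k <- msupp v) inf_index k).+1; apply/in_levelP => k mk.
apply/eqP; rewrite mcoeff_eq0; apply/negP => kv.
by move: mk; rewrite ltnNge => /negP; apply; apply: leq_bigmax_seq.
Qed.

Lemma in_level_seq (s : seq V) : exists m, {in s, forall v, in_level m v}.
Proof.
elim: s => [|v s [m sm]]; first by exists 0.
have [n vn] := in_level_ex v; exists (maxn m n) => w; rewrite inE.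
by case/predU1P => [->|/sm]; [move: vn|]; apply: in_level_leq; rewrite leq_max leqnn ?orbT.
Qed.

Lemma in_level_map m (s : seq V) : {in s, forall v, in_level m v} ->
  exists t : seq (V_ m 0), map (@std_emb m) t = s.
Proof.
elim: s => [|v s IH] sm; first by exists [::].
have [|t <-] := IH; first by move=> w ws; apply: sm; rewrite inE ws orbT.
by have [u <-] := sm v (mem_head _ _); exists (u :: t).
Qed.

Lemma in_level_span m (s : seq V) : {in s, forall v, in_level m v} ->
  forall x, span_of s x -> in_level m x.
Proof.
apply: span_of_closed; first by exists 0; rewrite (embedding0 (std_embP m)).
by move=> c _ _ [u <-] [v <-]; exists (c *: u + v); rewrite (embeddingP (std_embP m)).
Qed.

Lemma infSpace_nondegenerate : nondegenerate V.
Proof.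
move=> v v0; have [m [u uv]] := in_level_ex v.
have [|w uw] := @stdSpace_nondegenerate m u.
  by move=> u0; apply: v0; rewrite -uv u0 (embedding0 (std_embP m)).
by exists (std_emb w); rewrite -uv; case: (std_embP m) => _ _ ->.
Qed.

Lemma e_notin_level m : ~ in_level m (e_ K m).
Proof.
move=> /in_levelP/(_ (inl m) (leqnn _))/eqP.
by rewrite mcoeffU eqxx oner_eq0.
Qed.

Lemma e_perp_level m v : in_level m v -> altform v (e_ K m) = 0.
Proof.
move=> [u <-]; rewrite altform_suml big1 // => i _; rewrite !altformE !altform_basisE.
by rewrite ltn_eqF //= oppr0 !mulr0 addr0.
Qed.

End StandardEmbedding.

Section SmoothSets.
Variable F : finFieldType.
Local Notation V := (infSpace F).
Local Notation G := (aut V).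
Implicit Types (X Y Z : smoothSet F) (s t : seq V) (g h : G).

Lemma stab_fixes X (x : X) :
  exists s, forall g, act g x = x <-> fixes g s.
Proof. by have [A Ax] := act_smooth x; exists A. Qed.

Lemma actK X g : cancel (@act F X g) (act g^-1%g).
Proof. by move=> x; rewrite -actM mulVg act1. Qed.

Lemma actVK X g : cancel (@act F X g^-1%g) (act g).
Proof. by move=> x; rewrite -actM mulgV act1. Qed.

Lemma smap_eq_at Y X (f f' : smoothMap Y X) y : f y = f' y -> f = f'.
Proof.
move=> ff'; have : f =1 f'.
  by move=> z; have [g <-] := act_transitive y z; rewrite !smapP ff'.
case: f f' {ff'} => [f fP] [f' f'P] /= /funext ff'.
by rewrite ff' in fP *; congr SmoothMap; apply: Prop_irrelevance.
Qed.

Lemma smap_of_stab Y X (y : Y) (x : X) :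
  (forall g, act g y = y -> act g x = x) -> exists f : smoothMap Y X, f y = x.
Proof.
move=> yx; pose gy z := sval (cid (act_transitive y z)).
have gyE z : act (gy z) y = z by rewrite /gy; case: cid.
have eqx g h : act g y = act h y -> act g x = act h x.
  move=> gh; have ghx : act (g^-1 * h)%g x = x by apply: yx; rewrite actM -gh actK.
  by rewrite -{1}ghx -actM mulgA mulgV mul1g.
have fP : equivariant (@act F Y) (@act F X) (fun z => act (gy z) x).
  by move=> g z; rewrite -actM; apply: eqx; rewrite actM !gyE.
by exists (SmoothMap fP) => /=; rewrite -[RHS](act1 x); apply: eqx; rewrite gyE act1.
Qed.

Lemma smap_bij Y X (f : smoothMap Y X) (y : Y) :
  (forall g, act g (f y) = f y -> act g y = y) -> bijective f.
Proof.
move=> fy; have [|f' f'y] := @smap_of_stab X Y (f y) y; first exact: fy.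
exists f' => z.
  by have [g <-] := act_transitive y z; rewrite !smapP f'y.
by have [g <-] := act_transitive (f y) z; rewrite !smapP f'y.
Qed.

Lemma symb_iso Y X (f : smoothMap Y X) : bijective f -> [symb f] = 1.
Proof. by move=> fb; apply/theta_clP/Tsym_iso. Qed.

Lemma symb_comp Z Y X (f : smoothMap Y X) (g : smoothMap Z Y) :
  [symb smap_comp f g] = [symb f] * [symb g].
Proof.
by rewrite [RHS]theta_mulE; apply/theta_clP/Tsym_comp.
Qed.

Lemma symb_base Y X X' (f : smoothMap Y X) (h : smoothMap X' X) n
    (Y' : 'I_n -> smoothSet F) (p : forall i, smoothMap (Y' i) Y)
    (f' : forall i, smoothMap (Y' i) X') :
  fibre_product_orbits f h p f' -> [symb f] = \sum_(i < n) [symb f' i].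
Proof.
move=> /Tsym_base/theta_clP fE; rewrite [LHS]fE.
by elim/big_rec2: _ => [|i x t _ IH] //; rewrite -[theta_cl _]theta_addE IH.
Qed.

Lemma symb_stab Y Y' X (f : smoothMap Y X) (f' : smoothMap Y' X) y y' :
  f y = f' y' -> (forall g, act g y = y <-> act g y' = y') -> [symb f] = [symb f'].
Proof.
move=> ff' yy'; have [|k ky] := @smap_of_stab Y Y' y y'; first by move=> g /yy'.
have -> : f = smap_comp f' k by apply: (@smap_eq_at _ _ _ _ y); rewrite /= ky.
rewrite symb_comp (symb_iso (f := k)) ?mulr1 //.
by apply: (@smap_bij _ _ _ y) => g; rewrite ky => /yy'.
Qed.

Lemma symb_stab1 Y X (f : smoothMap Y X) y :
  (forall g, act g (f y) = f y -> act g y = y) -> [symb f] = 1.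
Proof. by move=> fy; apply/symb_iso/smap_bij/fy. Qed.

Definition code (v : V) : nat := choice.pickle [seq (k, v@_k) | k <- enum_fset (msupp v)].

Lemma code_inj : injective code.
Proof.
move=> u v /(pcan_inj choice.pickleK) uv.
have supp : enum_fset (msupp u) = msupp v.
  by have := congr1 unzip1 uv; rewrite /unzip1 -!map_comp !map_id.
have suppE k : (k \in msupp u) = (k \in msupp v) by rewrite -[LHS]/(k \in enum_fset _) supp.
rewrite supp in uv; apply/malgP => k; have [kv|kv] := boolP (k \in msupp v).
  by have /eq_in_map/(_ k kv)[] := uv.
by rewrite !mcoeff_outdom ?suppE.
Qed.

Definition codes s : nat := choice.pickle (map code s).

Lemma codes_inj : injective codes.
Proof. by move=> s t /(pcan_inj choice.pickleK)/(inj_map code_inj). Qed.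

(* The carrier of a smooth set lies in [Set] but [F], hence [V], need not: an
   element of the orbit of [s] is represented by its code. *)
Section OrbitOf.
Variable s : seq V.

Definition orb : Set := {n : nat | `[< exists g : G, n = codes (map g s) >]}.

Definition orb_mk g : orb :=
  exist _ (codes (map g s)) (asboolT (ex_intro _ g erefl)).

Definition orb_elt (x : orb) : seq V := map (sval (cid (asboolW (svalP x)))) s.

Lemma codes_orb_elt x : codes (orb_elt x) = sval x.
Proof. by rewrite /orb_elt; case: cid. Qed.

Lemma orb_elt_inj : injective orb_elt.
Proof.
by move=> x y xy; apply: val_inj; rewrite /= -!codes_orb_elt xy.
Qed.

Lemma orb_elt_mk g : orb_elt (orb_mk g) = map g s.
Proof. by apply: codes_inj; rewrite codes_orb_elt. Qed.

Lemma orb_eltE x : exists g, orb_elt x = map g s.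
Proof. by exists (sval (cid (asboolW (svalP x)))). Qed.

Definition orb_act g (x : orb) : orb := orb_mk (g * sval (cid (orb_eltE x)))%g.

Lemma orb_elt_act g x : orb_elt (orb_act g x) = map g (orb_elt x).
Proof.
by rewrite orb_elt_mk; case: cid => h /= ->; rewrite -map_comp.
Qed.

Lemma orb_act1 x : orb_act 1%g x = x.
Proof. by apply: orb_elt_inj; rewrite orb_elt_act map_id. Qed.

Lemma orb_actM g h x : orb_act (g * h)%g x = orb_act g (orb_act h x).
Proof. by apply: orb_elt_inj; rewrite !orb_elt_act -map_comp. Qed.

Lemma orb_inhabited : exists x : orb, True. Proof. by exists (orb_mk 1%g). Qed.

Lemma orb_transitive x y : exists g, orb_act g x = y.
Proof.
have [g xg] := orb_eltE x; have [h yh] := orb_eltE y; exists (h * g^-1)%g.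
apply: orb_elt_inj; rewrite orb_elt_act xg yh -map_comp.
by apply: eq_map => u /=; rewrite aut_funK.
Qed.

Lemma orb_stab g x : orb_act g x = x <-> fixes g (orb_elt x).
Proof.
rewrite fixes_map -orb_elt_act; split=> [->//|]; exact: orb_elt_inj.
Qed.

Lemma orb_smooth x : exists A : {fset V},
  forall g, orb_act g x = x <-> {in A, forall v, g v = v}.
Proof.
exists [fset v in orb_elt x]%fset => g; rewrite orb_stab.
by split=> gx v vx; apply: gx; move: vx; rewrite inE.
Qed.

Definition orbit_of : smoothSet F :=
  SmoothSet orb_act1 orb_actM orb_inhabited orb_transitive orb_smooth.

End OrbitOf.

Definition orb_base s : orbit_of s := orb_mk s 1%g.

Lemma orb_elt_base s : orb_elt (orb_base s) = s.
Proof. by rewrite orb_elt_mk map_id. Qed.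

Lemma orb_base_stab s g : act g (orb_base s) = orb_base s <-> fixes g s.
Proof. by rewrite [act g _ = _]orb_stab orb_elt_base. Qed.

Lemma orb_ex s t g : t = map g s -> exists x : orbit_of s, orb_elt x = t.
Proof. by move=> ->; exists (orb_mk s g); rewrite orb_elt_mk. Qed.

Lemma drop_map_ex t s :
  exists f : smoothMap (orbit_of (t ++ s)) (orbit_of s), f (orb_base _) = orb_base s.
Proof. by apply: smap_of_stab => g; rewrite !orb_base_stab fixes_cat => -[]. Qed.

Definition drop_map t s := sval (cid (drop_map_ex t s)).

Lemma drop_map_base t s : drop_map t s (orb_base _) = orb_base s.
Proof. by rewrite /drop_map; case: cid. Qed.

Lemma orb_elt_drop t s (x : orbit_of (t ++ s)) :
  orb_elt (drop_map t s x) = drop (size t) (orb_elt x).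
Proof.
have [g <-] := act_transitive (orb_base _) x.
rewrite smapP drop_map_base !orb_elt_act !orb_elt_base -map_drop.
by rewrite drop_size_cat.
Qed.

Definition proj v s : smoothMap (orbit_of (v :: s)) (orbit_of s) :=
  drop_map [:: v] s.

Lemma orb_elt_proj v s (x : orbit_of (v :: s)) :
  orb_elt (proj v s x) = behead (orb_elt x).
Proof. by rewrite (@orb_elt_drop [:: v]) drop1. Qed.

Section Factorization.
Variable Q : forall Y X, smoothMap Y X -> Prop.
Hypothesis Q_iso : forall Y X (f : smoothMap Y X), bijective f -> Q f.
Hypothesis Q_comp : forall Z Y X (f : smoothMap Y X) (g : smoothMap Z Y),
  Q f -> Q g -> Q (smap_comp f g).
Hypothesis Q_proj : forall s v, independent (v :: s) -> Q (proj v s).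

Lemma factor_drop_map r s : independent (r ++ s) -> Q (drop_map r s).
Proof.
elim: r => [_|v r IH vrs].
  apply/Q_iso/(@smap_bij _ _ _ (orb_base _)) => g.
  by rewrite drop_map_base !orb_base_stab.
have -> : drop_map (v :: r) s = smap_comp (drop_map r s) (proj v (r ++ s)).
  by apply: (@smap_eq_at _ _ _ _ (orb_base _)); rewrite /= !drop_map_base.
by apply: Q_comp; [apply: IH; case: vrs | apply: Q_proj].
Qed.

Lemma smoothMap_ind Y X (f : smoothMap Y X) : Q f.
Proof.
have [y _] := act_inhabited Y.
have [s0 s0x] := stab_fixes (f y); have [t ty] := stab_fixes y.
have [s] := @independent_extend _ _ [::] s0 I; rewrite !cats0 => -[s_ind ss0].
have sx g : act g (f y) = f y <-> fixes g s.
  by rewrite s0x; apply: iff_sym; apply: fixes_eq_span.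
have [r [rs_ind rs]] := independent_extend t s_ind.
have rsy g : act g y = y <-> fixes g (r ++ s).
  rewrite (fixes_eq_span rs) fixes_cat -sx -ty.
  by split=> [gy|[]//]; split=> //; rewrite -smapP gy.
have [|a ax] := @smap_of_stab (orbit_of s) X (orb_base s) (f y).
  by move=> g; rewrite orb_base_stab sx.
have [|b yb] := @smap_of_stab Y (orbit_of (r ++ s)) y (orb_base _).
  by move=> g; rewrite orb_base_stab rsy.
have -> : f = smap_comp a (smap_comp (drop_map r s) b).
  by apply: (@smap_eq_at _ _ _ _ y); rewrite /= yb drop_map_base ax.
apply: Q_comp; first by apply/Q_iso/(@smap_bij _ _ _ (orb_base s)) => g; rewrite ax orb_base_stab sx.
apply: Q_comp; first exact: factor_drop_map.
by apply/Q_iso/(@smap_bij _ _ _ y) => g; rewrite yb orb_base_stab rsy.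
Qed.

End Factorization.

End SmoothSets.

Section BaseChange.
Variable F : finFieldType.
Local Notation V := (infSpace F).
Local Notation G := (aut V).
Local Notation q := #|F|.
Implicit Types (X Y Z : smoothSet F) (s t : seq V) (g h : G).

Section PairOrbit.
Variables (Y X : smoothSet F) (y0 : Y) (x0 : X).

Definition in_pair_orb (p : Y * X) : bool :=
  `[< exists g, (act g y0, act g x0) = p >].

Definition pair_orb : Set := {p : Y * X | in_pair_orb p}.

Lemma pair_orb_inj (a b : pair_orb) : sval a = sval b -> a = b.
Proof.
case: a b => p pP [p' p'P] /= pp'; rewrite pp' in pP *.
by congr exist; apply: bool_irrelevance.
Qed.

Lemma pair_act_subproof g (a : pair_orb) :
  in_pair_orb (act g (sval a).1, act g (sval a).2).
Proof.
case: a => p /= /asboolP[h <-]; apply/asboolP.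
by exists (g * h)%g; rewrite !actM.
Qed.

Definition pair_act g (a : pair_orb) : pair_orb :=
  exist in_pair_orb _ (pair_act_subproof g a).

Lemma pair_act1 a : pair_act 1%g a = a.
Proof. by apply: pair_orb_inj => /=; rewrite !act1; case: (sval a). Qed.

Lemma pair_actM g h a : pair_act (g * h)%g a = pair_act g (pair_act h a).
Proof. by apply: pair_orb_inj => /=; rewrite !actM. Qed.

Definition pair_base : pair_orb :=
  exist in_pair_orb (y0, x0) (asboolT (ex_intro _ 1%g (congr2 pair (act1 y0) (act1 x0)))).

Lemma pair_baseE a : exists g, pair_act g pair_base = a.
Proof. by case: a => p /[dup] /asboolW[g gp] pP; exists g; apply: pair_orb_inj. Qed.

Lemma pair_inhabited : exists a : pair_orb, True. Proof. by exists pair_base. Qed.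

Lemma pair_transitive a b : exists g, pair_act g a = b.
Proof.
have [g <-] := pair_baseE a; have [h <-] := pair_baseE b.
by exists (h * g^-1)%g; rewrite -pair_actM -mulgA mulVg mulg1.
Qed.

Lemma pair_stab g a :
  pair_act g a = a <-> act g (sval a).1 = (sval a).1 /\ act g (sval a).2 = (sval a).2.
Proof.
split=> [ga|[gy gx]]; first by rewrite -{2 4}ga.
by apply: pair_orb_inj; rewrite /= gy gx; case: (sval a).
Qed.

Lemma pair_smooth a : exists A : {fset V},
  forall g, pair_act g a = a <-> {in A, forall v, g v = v}.
Proof.
have [A Ay] := act_smooth (sval a).1; have [B Bx] := act_smooth (sval a).2.
exists (A `|` B)%fset => g; rewrite pair_stab Ay Bx; split=> [[gA gB] v|gAB].
  by rewrite inE => /orP[/gA|/gB].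
by split=> v vAB; apply: gAB; rewrite inE vAB ?orbT.
Qed.

Definition pair_orbit : smoothSet F :=
  SmoothSet pair_act1 pair_actM pair_inhabited pair_transitive pair_smooth.

Definition pair_fst : smoothMap pair_orbit Y :=
  @SmoothMap _ pair_orbit Y (fun a => (sval a).1) (fun _ _ => erefl).

Definition pair_snd : smoothMap pair_orbit X :=
  @SmoothMap _ pair_orbit X (fun a => (sval a).2) (fun _ _ => erefl).

End PairOrbit.

Lemma symb_base_orbits Y X X' (f : smoothMap Y X) (h : smoothMap X' X) (x0 : X')
    (I : finType) (y : I -> Y) :
  (forall i, f (y i) = h x0) ->
  (forall y', f y' = h x0 -> exists i g, act g x0 = x0 /\ act g (y i) = y') ->
  (forall i j g, act g x0 = x0 -> act g (y i) = y j -> i = j) ->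
  [symb f] = \sum_i [symb pair_snd (y i) x0].
Proof.
move=> fy y_onto y_inj; pose k (i : 'I_#|I|) : I := enum_val i.
rewrite (big_enum_val (fun i => [symb pair_snd (y i) x0])).
apply: (@symb_base _ _ _ _ _ h _ _ (fun i => pair_fst (y (k i)) x0)); split.
  move=> i [[y1 x1] /= /asboolW[g [<- <-]]]; by rewrite !smapP fy.
move=> y1 x1 fy1; have [g gx] := act_transitive x0 x1.
have [|i [a [ax ay]]] := y_onto (act g^-1%g y1).
  by rewrite smapP fy1 -gx smapP actK.
have pP : in_pair_orb (y (k (enum_rank i))) x0 (y1, x1).
  apply/asboolP; exists (g * a)%g.
  by rewrite /k enum_rankK !actM ax ay actVK gx.
pose c : pair_orbit (y (k (enum_rank i))) x0 := exist (in_pair_orb _ _) _ pP.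
exists (Tagged (fun i => carrier (pair_orbit (y (k i)) x0)) c).
split=> // -[j [[y2 x2] p2P]] /= [y21 x21].
have ji : j = enum_rank i.
  have /asboolW[b [by2 bx2]] := p2P.
  apply: enum_val_inj; rewrite enum_rankK.
  apply/esym/(y_inj _ _ ((b^-1 * (g * a))%g)).
    by rewrite !actM ax gx -x21 -bx2 actK.
  by rewrite !actM ay actVK -y21 -by2 actK.
rewrite ji in p2P *; congr existT; apply: pair_orb_inj => /=.
by rewrite y21 x21.
Qed.

Lemma orb_cons_ex s v w : ~ span_of s v -> ~ span_of s w -> pairs s v = pairs s w ->
  exists y : orbit_of (v :: s), orb_elt y = w :: s.
Proof.
move=> sv sw vw; have [g gs gv] := witt_step (@infSpace_nondegenerate F) sv sw vw.
by apply: (@orb_ex _ _ _ g); rewrite /= gv (fixes_map g s).1.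
Qed.

Lemma proj_eq_base v s (y : orbit_of (v :: s)) w : orb_elt y = w :: s ->
  proj v s y = orb_base s.
Proof. by move=> yw; apply: orb_elt_inj; rewrite orb_elt_proj yw orb_elt_base. Qed.

Lemma orb_cons_fibre v s (y : orbit_of (v :: s)) : independent (v :: s) ->
  proj v s y = orb_base s ->
  exists w, [/\ orb_elt y = w :: s, ~ span_of s w & pairs s w = pairs s v].
Proof.
move=> [sv _] ys; have [g gy] := orb_eltE y; exists (g v).
have gs : map g s = s by rewrite -[RHS]orb_elt_base -ys orb_elt_proj gy.
split; first by rewrite gy /= gs.
  by rewrite -gs (span_of_map (autP g)).
by rewrite -{1}gs (pairs_map (autP g)).
Qed.

Definition self_dual s : Prop :=
  forall l, size l = size s -> exists2 w, span_of s w & pairs s w = l.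

Section SelfDual.
Variables (t s : seq V) (z : V).
Let r := t ++ s.
Hypothesis r_ind : independent r.
Hypothesis r_dual : self_dual r.
Hypothesis rz : ~ span_of r z.
Hypothesis z_perp : {in r, forall u, altform u z = 0}.

Let s_sub_r u : span_of s u -> span_of r u.
Proof.
by apply: sub_span_of => w ws; apply: mem_span_of; rewrite mem_cat ws orbT.
Qed.

Let pairs_r w : pairs s w = drop (size t) (pairs r w).
Proof. by rewrite /r /pairs map_cat drop_size_cat // size_map. Qed.

Lemma symb_proj_self_dual v : independent (v :: s) ->
  exists n, [symb proj v s] = n%:R +
    [symb proj z r] *+ #|[pred l : (size r).-tuple F | drop (size t) l == pairs s v]|.
Proof.
move=> vs_ind; have [sv _] := vs_ind.
pose P (a : (size r).-tuple F) :=
  `[< ~ span_of s (lincomb r a) /\ pairs s (lincomb r a) = pairs s v >].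
pose I := ({a : (size r).-tuple F | P a} +
  {l : (size r).-tuple F | drop (size t) l == pairs s v})%type.
have dualP (l : (size r).-tuple F) : exists w, span_of r w /\ pairs r w = l.
  by have [|w rw wl] := r_dual (l := l); [rewrite size_tuple | exists w].
pose d (l : (size r).-tuple F) := sval (cid (dualP l)).
have dP l : span_of r (d l) /\ pairs r (d l) = l by rewrite /d; case: cid.
have dz l : ~ span_of r (d l + z).
  move=> rdz; apply: rz; rewrite -[z](addKr (d l)) addrC.
  by apply: span_ofB => //; case: (dP l).
have pdz l : pairs r (d l + z) = l.
  rewrite -[RHS](dP l).2; apply/eq_in_map => u ur.
  by rewrite altformDr z_perp // addr0.
pose w (i : I) := match i with inl a => lincomb r (sval a) | inr l => d (sval l) + z end.
have wP i : ~ span_of s (w i) /\ pairs s (w i) = pairs s v.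
  case: i => -[l lP] /=; first by move/asboolP: lP.
  by split; [move=> /s_sub_r/dz | rewrite pairs_r pdz (eqP lP)].
have yP i : exists y : orbit_of (v :: s), orb_elt y = w i :: s.
  by apply: orb_cons_ex => //; case: (wP i).
pose y i := sval (cid (yP i)).
have yE i : orb_elt (y i) = w i :: s by rewrite /y; case: cid.
have stab_y i g : act g (y i) = y i <-> fixes g (w i :: s).
  by rewrite [act g _ = _]orb_stab yE.
have -> : [symb proj v s] = \sum_i [symb pair_snd (y i) (orb_base r)].
  apply: (symb_base_orbits (h := drop_map t s)) => [i|y'|i j g].
  - by rewrite drop_map_base (proj_eq_base (yE i)).
  - rewrite drop_map_base => /(orb_cons_fibre vs_ind)[w' [y'E sw' pw']].
    have [i [g [gr gw]]] : exists i g, fixes g r /\ g (w i) = w'.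
      have [/span_ofP[a aw' _]|rw'] := pselect (span_of r w').
        have aP : P a by apply/asboolP; rewrite aw'.
        by exists (inl (exist _ a aP)), 1%g.
      have lP : drop (size t) (pairs r w') == pairs s v by rewrite -pairs_r pw'.
      have lr : size (pairs r w') == size r by rewrite size_pairs.
      have [|g gr gw] := witt_step (@infSpace_nondegenerate F) (dz (Tuple lr)) rw'.
        by rewrite pdz.
      by exists (inr (exist _ (Tuple lr) lP)), g.
    exists i, g; rewrite orb_base_stab; split=> //.
    apply: orb_elt_inj; rewrite orb_elt_act yE y'E /= gw; congr (_ :: _).
    by apply/fixes_map => u us; apply: gr; rewrite mem_cat us orbT.
  rewrite orb_base_stab => gr /(congr1 (@orb_elt _ _)).
  rewrite orb_elt_act !yE /= => -[gw _].
  case: i j gw => -[l lP] [[l' l'P]|[l' l'P]] /= gw.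
  - congr inl; apply: val_inj; apply: (lincomb_inj r_ind).
    by rewrite /= -gw (fixes_span gr) //; apply/span_ofP; exists l.
  - case: (dz l'); rewrite -gw (fixes_span gr); by apply/span_ofP; exists l.
  - case: (dz l); rewrite -(span_of_map (autP g)) gw (fixes_map _ _).1 //.
    by apply/span_ofP; exists l'.
  - congr inr; apply: val_inj; apply: val_inj; rewrite /= -(pdz l) -(pdz l') -gw.
    by rewrite -{2}((fixes_map g r).1 gr) (pairs_map (autP g)).
exists #|[pred a | P a]|; rewrite big_sumType /=; congr (_ + _).
  rewrite (eq_bigr (fun=> 1)) ?sumr_const ?card_sig // => i _.
  pose b : pair_orbit (y (inl i)) (orb_base r) := pair_base _ _.
  apply: (symb_stab1 (y := b)) => g /orb_base_stab gr.
  apply/pair_stab; rewrite /= stab_y orb_base_stab; split=> //; apply/fixes_cons.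
  split; first by apply: (fixes_span gr); apply/span_ofP; exists (sval i).
  by move=> u us; apply: gr; rewrite mem_cat us orbT.
rewrite (eq_bigr (fun=> [symb proj z r])) ?sumr_const ?card_sig // => l _.
pose b : pair_orbit (y (inr l)) (orb_base r) := pair_base _ _.
apply: (symb_stab (y := b) (y' := orb_base (z :: r))).
  by rewrite (proj_eq_base (orb_elt_base _)).
move=> g; rewrite [act g _ = _]pair_stab /= stab_y !orb_base_stab /=.
have dlz gr := fixes_span (g := g) gr (dP (sval l)).1.
rewrite !fixes_cons /r fixes_cat -/r; split.
  move=> [[gdz gs] [gt _]]; have gr : fixes g r by apply/fixes_cat.
  by split=> //; move: gdz; rewrite (embeddingD (autP g)) dlz // => /addrI.
move=> [gz [gt gs]]; have gr : fixes g r by apply/fixes_cat.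
by rewrite (embeddingD (autP g)) dlz // gz.
Qed.

End SelfDual.

Lemma perp_vector_ex s : exists2 z, ~ span_of s z & {in s, forall u, altform u z = 0}.
Proof.
have [m sm] := in_level_seq s; exists (e_ F m) => [/(in_level_span sm)|u us].
  exact: e_notin_level.
exact/e_perp_level/sm.
Qed.

Lemma self_dual_extend s : independent s ->
  exists t, independent (t ++ s) /\ self_dual (t ++ s).
Proof.
move=> s_ind; have [m sm] := in_level_seq s.
pose B := [seq std_emb u | u <- enum {: stdSpace F m 0}].
have Bm : {in B ++ s, forall v, in_level m v}.
  by move=> v; rewrite mem_cat => /orP[/mapP[u _ ->]|/sm//]; exists u.
have [t [ts_ind tsB]] := independent_extend B s_ind.
exists t; split=> // l lt.
have [|u uE] := @in_level_map _ m (t ++ s).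
  by move=> v vs; apply: (in_level_span Bm); apply/tsB/mem_span_of.
have u_ind : independent u by rewrite -(independent_map (std_embP F m)) uE.
have [|w wl] := pairs_surj (@stdSpace_nondegenerate _ m) (l := l) u_ind.
  by rewrite lt -uE size_map.
exists (std_emb w); last by rewrite -uE (pairs_map (std_embP F m)).
apply/tsB/mem_span_of; by rewrite mem_cat map_f ?mem_enum.
Qed.

Definition tau : Theta F := [symb proj (e_ F 0) [::]].

Lemma independent_e0 : independent [:: e_ F 0].
Proof.
by split=> //= e0; apply: (@e_notin_level F 0); rewrite e0; exists 0;
   rewrite (embedding0 (std_embP F 0)).
Qed.

Lemma symb_proj_tau v s : independent (v :: s) ->
  exists k N (c : int), [symb proj v s] *+ q ^ k = tau *+ N + c%:~R.
Proof.
move=> vs_ind; have [_ s_ind] := vs_ind.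
have [t [ts_ind ts_dual]] := self_dual_extend s_ind.
have [z tsz z_perp] := perp_vector_ex (t ++ s).
have [n ->] := symb_proj_self_dual ts_ind ts_dual tsz z_perp vs_ind.
have := @symb_proj_self_dual (t ++ s) [::] z; rewrite cats0.
move=> /(_ ts_ind ts_dual tsz z_perp _ independent_e0)[m tauE].
set r := t ++ s in tauE *; set A := [symb proj z r] in tauE *; set N := #|_|.
exists (size r), N, ((n * q ^ size r)%N%:Z - (m * N)%N%:Z).
have cardT : #|[pred l : (size r).-tuple F | drop (size r) l == [::]]| = (q ^ size r)%N.
  rewrite -card_tuple; apply: eq_card => l; rewrite !inE.
  by rewrite drop_oversize ?size_tuple.
rewrite cardT -/tau in tauE.
rewrite tauE rmorphB /= -!pmulrn !mulrnA !mulrnDl.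
by rewrite [RHS]addrC -[RHS]addrA addKr (mulrnAC A).
Qed.

End BaseChange.

Section Cardinality.
Implicit Types (T : Type) (n : nat).

Definition has_card T (P : T -> Prop) n : Prop :=
  exists e : 'I_n -> T, injective e /\ forall x, P x <-> exists i, e i = x.

Lemma has_card_fin T (P : T -> Prop) (I : finType) (e : I -> T) :
  injective e -> (forall x, P x <-> exists i, e i = x) -> has_card P #|I|.
Proof.
move=> e_inj eP; exists (e \o enum_val); split=> [|x].
  exact: inj_comp e_inj enum_val_inj.
by rewrite eP; split=> -[i <-]; [exists (enum_rank i); rewrite /= enum_rankK | exists (enum_val i)].
Qed.

Lemma has_card_leq T (P : T -> Prop) n m : has_card P n -> has_card P m -> (n <= m)%N.
Proof.
move=> [e [e_inj eP]] [d [_ dP]].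
have ed i : exists j, d j = e i by apply/dP/eP; exists i.
pose f i := sval (cid (ed i)).
have fE i : d (f i) = e i by rewrite /f; case: cid.
rewrite -(card_ord n) -(card_ord m); apply: (@leq_card _ _ f) => i j ij.
by apply: e_inj; rewrite -!fE ij.
Qed.

Lemma has_card_uniq T (P : T -> Prop) n m : has_card P n -> has_card P m -> n = m.
Proof. by move=> Pn Pm; apply/eqP; rewrite eqn_leq !(@has_card_leq _ P). Qed.

Lemma has_card_tagged (I : finType) (N : I -> nat) (A : I -> Type)
    (P : forall i, A i -> Prop) T (Q : T -> Prop) (f : forall i, A i -> T) :
  (forall i, has_card (P i) (N i)) ->
  (forall s s' : {i : I & A i}, P _ (tagged s) -> P _ (tagged s') ->
     f _ (tagged s) = f _ (tagged s') -> s = s') ->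
  (forall y, Q y <-> exists i a, P i a /\ f i a = y) ->
  has_card Q (\sum_i N i).
Proof.
move=> PN f_inj QP; pose e i := sval (cid (PN i)).
have eP i : injective (e i) /\ forall a, P i a <-> exists j, e i j = a.
  by rewrite /e; case: cid.
have Pe i j : P i (e i j) by apply/(eP i).2; exists j.
have -> : (\sum_i N i = #|{: {i : I & 'I_(N i)}}|)%N.
  rewrite card_tagged sumnE big_map big_enum /=.
  by apply: eq_bigr => i _; rewrite card_ord.
apply: (@has_card_fin _ _ {i : I & 'I_(N i)} (fun s => f _ (e _ (tagged s)))).
  move=> [i j] [i' j'] /= ff.
  have := f_inj (Tagged A (e i j)) (Tagged A (e i' j')) (Pe _ _) (Pe _ _) ff.
  move=> ss'; have ii' : i = i' := congr1 tag ss'.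
  rewrite -ii' in j' ss' ff *; congr existT; apply: (eP i).1.
  exact: eq_from_Tagged ss'.
move=> y; rewrite QP; split.
  by move=> [i [a [/(eP i).2[j <-] <-]]]; exists (Tagged (fun i => 'I_(N i)) j).
by move=> [[i j] <-]; exists i, (e i j).
Qed.

End Cardinality.

Section Zinv.
Variable n : nat.
Hypothesis n_gt1 : (1 < n)%N.
Local Notation Zn := (Zinv n).

Lemma Zinv_inv_subproof : n%:R^-1 \in Zinv_pred n.
Proof. by apply/asboolP; exists 1%N; rewrite expr1 mulVf // pnatr_eq0; lia. Qed.

Definition Zinv_inv : Zn := Sub n%:R^-1 Zinv_inv_subproof.

Lemma Zinv_invK k (x : Zn) : n%:R ^+ k * (Zinv_inv ^+ k * x) = x.
Proof.
rewrite mulrA -exprMn; suff -> : n%:R * Zinv_inv = 1 by rewrite expr1n mul1r.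
apply: val_inj; rewrite rmorphM rmorph_nat /= mulfV // pnatr_eq0; lia.
Qed.

Lemma Zinv_poly_eq (P Q : {poly Zn}) M :
  (forall m, (M <= m)%N -> P.[n%:R ^+ (2 * m)] = Q.[n%:R ^+ (2 * m)]) -> P = Q.
Proof.
move=> PQ; pose v : {rmorphism Zn -> rat} := \val.
apply: (map_inj_poly (f := v)); [exact: val_inj | exact: rmorph0 |].
apply/eqP; rewrite -subr_eq0 -(rmorphB (map_poly v)); apply/negPn/negP.
set R := map_poly v (P - Q) => R0.
pose rs := [seq (n%:R ^+ (2 * (M + i)) : rat) | i <- iota 0 (size R)].
have R_rs : all (root R) rs.
  apply/allP => _ /mapP[i _ ->]; rewrite rootE.
  have -> : n%:R ^+ (2 * (M + i)) = v (n%:R ^+ (2 * (M + i))).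
    by rewrite rmorphXn rmorph_nat.
  by rewrite horner_map hornerD hornerN PQ ?subrr ?rmorph0 // leq_addr.
have rs_uniq : uniq rs.
  rewrite map_inj_uniq ?iota_uniq // => i j /eqP.
  rewrite -!natrX eqr_nat eqn_exp2l // => /eqP; lia.
by have := max_poly_roots R0 R_rs rs_uniq; rewrite size_map size_iota ltnn.
Qed.

End Zinv.

Section Counting.
Variable F : finFieldType.
Local Notation V := (infSpace F).
Local Notation G := (aut V).
Local Notation V_ m n := (stdSpace F m n).
Local Notation q := #|F|.
Local Notation Zq := (Zinv q).
Implicit Types (X Y Z : smoothSet F) (s t : seq V) (g h : G).

Lemma card_field_gt1 : (1 < q)%N. Proof. exact: card_finNzRing_gt1. Qed.

Lemma card_stdSpace m : #|{: V_ m 0}| = (q ^ (2 * m))%N.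
Proof. by rewrite !card_prod !card_mx !mul1n expn0 muln1 -expnD addnn mul2n. Qed.

Lemma card_pairs m (u : seq (V_ m 0)) l : independent u -> size l = size u ->
  (#|[pred w | pairs u w == l]| * q ^ size u = q ^ (2 * m))%N.
Proof.
move=> u_ind lu; rewrite -card_stdSpace -(card_tuple (size u)) mulnC -sum_nat_const.
rewrite -[RHS]sum1_card.
pose pt w : (size u).-tuple F := [tuple of map (altform^~ w) (in_tuple u)].
rewrite [RHS](partition_big pt xpredT) //=; apply: eq_bigr => l' _.
rewrite -sum1_card.
have nd := @stdSpace_nondegenerate F m.
have [a al] := pairs_surj nd u_ind lu.
have [|b bl'] := pairs_surj nd (l := l') u_ind; first by rewrite size_tuple.
rewrite [RHS](reindex_inj (addIr (b - a))) /=; apply: eq_bigl => w.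
rewrite inE -val_eqE /= -[map _ u]/(pairs u _) -al -bl'.
apply/eqP/eqP => /pairs_inP wab; apply/pairs_inP => v /wab.
  by move=> vw; rewrite !altformE vw addrCA subrr addr0.
rewrite !altformE => vw; apply: (addIr (altform v b - altform v a)).
by rewrite vw [RHS]addrCA subrr addr0.
Qed.

Definition fixed m X (x : X) : Prop :=
  forall g, (forall v, in_level m v -> g v = v) -> act g x = x.

Lemma fixed_smap m Y X (f : smoothMap Y X) y : fixed m y -> fixed m (f y).
Proof. by move=> yf g gm; rewrite -smapP yf. Qed.

Lemma level_closed m v :
  (forall g, (forall w, in_level m w -> g w = w) -> g v = v) -> in_level m v.
Proof.
move=> gv; pose B := [seq std_emb u | u <- enum {: V_ m 0}].
have Bm : {in B, forall w, in_level m w} by move=> w /mapP[u _ ->]; exists u.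
have [/(in_level_span Bm)//|vB] := pselect (span_of B v).
have [y By vy] := span_of_perp (@infSpace_nondegenerate F) vB.
have gm w : in_level m w -> transvection y 1 w = w.
  by move=> [u <-]; apply: (fixes_transvection 1 By); rewrite map_f // mem_enum.
have /eqP := gv _ gm; rewrite /= /transv mul1r -subr_eq0 addrC addKr scaler_eq0.
by rewrite (negPf vy) /= => /eqP y0; rewrite y0 altform0r eqxx in vy.
Qed.

Lemma fixed_orbP m s (x : orbit_of s) :
  fixed m x <-> {in orb_elt x, forall v, in_level m v}.
Proof.
split=> [xm v vx|xm g gm].
  by apply: level_closed => g gm; have /orb_stab := xm g gm; apply.
by apply/orb_stab => v /xm; apply: gm.
Qed.

Lemma fixed_ex X : exists M, forall m, (M <= m)%N -> exists x : X, fixed m x.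
Proof.
have [x _] := act_inhabited X; have [s sx] := stab_fixes x.
have [M sM] := in_level_seq s; exists M => m Mm; exists x => g gm.
by apply/sx => v /sM/(in_level_leq Mm)/gm.
Qed.

Definition count_poly Y X (f : smoothMap Y X) (P : {poly Zq}) : Prop :=
  forall m (x : X), fixed m x -> exists2 N,
    has_card (fun y => fixed m y /\ f y = x) N & P.[q%:R ^+ (2 * m)] = N%:R.

Lemma count_poly_iso Y X (f : smoothMap Y X) : bijective f -> count_poly f 1.
Proof.
move=> [f' fK f'K] m x xm; exists 1%N; last by rewrite hornerC.
exists (fun=> f' x); split=> [i j _|y]; first by rewrite !ord1.
split=> [[_ <-]|[_ <-]]; first by exists ord0; rewrite fK.
split=> // g gm; apply: (can_inj fK); by rewrite smapP f'K xm.
Qed.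

Lemma count_poly_comp Z Y X (f : smoothMap Y X) (g : smoothMap Z Y) P Q :
  count_poly f P -> count_poly g Q -> count_poly (smap_comp f g) (P * Q).
Proof.
move=> fP gQ m x xm; have [N [e [e_inj eP]] PN] := fP m x xm.
have eg i : exists k, has_card (fun z => fixed m z /\ g z = e i) k /\
    Q.[q%:R ^+ (2 * m)] = k%:R.
  have [|k kg kQ] := gQ m (e i); last by exists k.
  by case: (eP (e i)).2 => //; exists i.
pose k i := sval (cid (eg i)).
have kP i : has_card (fun z => fixed m z /\ g z = e i) (k i) /\
    Q.[q%:R ^+ (2 * m)] = (k i)%:R by rewrite /k; case: cid.
exists (\sum_i k i)%N.
  apply: (has_card_tagged (f := fun _ z => z) (fun i => (kP i).1)).
    move=> [i z] [j z'] /= [_ gz] [_ gz'] zz'.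
    by have -> : i = j; [apply: e_inj; rewrite -gz -gz' zz' | rewrite zz'].
  move=> z; split=> [[zm fgz]|[i [z' [[zm gz] <-]]]].
    have /eP[i gi] : fixed m (g z) /\ f (g z) = x by split=> //; apply: fixed_smap.
    by exists i, z.
  by split=> //=; rewrite gz; case: (eP (e i)).2 => //; exists i.
rewrite hornerM PN natr_sum (eq_bigr (fun=> Q.[q%:R ^+ (2 * m)])).
  by rewrite sumr_const card_ord mulr_natl.
by move=> i _; rewrite (kP i).2.
Qed.

Lemma count_poly_uniq Y X (f : smoothMap Y X) P Q :
  count_poly f P -> count_poly f Q -> P = Q.
Proof.
move=> fP fQ; have [M XM] := fixed_ex X.
apply: (Zinv_poly_eq card_field_gt1 (M := M)) => m /XM[x xm].
have [n fn ->] := fP m x xm; have [k fk ->] := fQ m x xm.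
by rewrite (has_card_uniq fn fk).
Qed.

Lemma count_poly_base Y X X' (f : smoothMap Y X) (h : smoothMap X' X) n
    (Y' : 'I_n -> smoothSet F) (p : forall i, smoothMap (Y' i) Y)
    (f' : forall i, smoothMap (Y' i) X') P (P' : 'I_n -> {poly Zq}) :
  fibre_product_orbits f h p f' -> count_poly f P ->
  (forall i, count_poly (f' i) (P' i)) -> P = \sum_(i < n) P' i.
Proof.
move=> [fp fpP] fP f'P'; have [M X'M] := fixed_ex X'.
apply: (Zinv_poly_eq card_field_gt1 (M := M)) => m /X'M[x xm].
have [N hN ->] := fP m (h x) (fixed_smap h xm).
have f'k i := cid2 (f'P' i m x xm).
rewrite horner_sum (eq_bigr (fun i => (s2val (f'k i))%:R)); last first.
  by move=> i _; case: (f'k i).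
rewrite -natr_sum; congr _%:R; apply: (has_card_uniq hN).
apply: (has_card_tagged (f := fun i => p i) (fun i => s2valP (f'k i))).
  move=> [i a] [j b] /= [am fa] [bm fb] pab.
  have [|[k c] [_ c_uniq]] := fpP (p i a) x; first by rewrite fp fa.
  have ca := c_uniq (existT _ i a) (conj erefl fa).
  exact: etrans (esym ca) (c_uniq (existT _ j b) (conj (esym pab) fb)).
move=> y; split=> [[ym fy]|[i [a [[am fa] <-]]]]; last first.
  by split; [apply: fixed_smap | rewrite fp fa].
have [[i a] [[/= pa fa] a_uniq]] := fpP y x fy.
exists i, a; split=> //; split=> // g gm.
have := a_uniq (existT _ i (act g a)); rewrite /= !smapP pa fa ym // xm //.
by move=> /(_ (conj erefl erefl)) aga; exact: eq_from_Tagged (esym aga).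
Qed.

Definition proj_poly (d c : nat) : {poly Zq} := Zinv_inv card_field_gt1 ^+ d *: 'X - c%:R%:P.

Lemma count_poly_proj v s : independent (v :: s) -> count_poly (proj v s)
  (proj_poly (size s)
     #|[pred a : (size s).-tuple F | pairs s (lincomb s a) == pairs s v]|).
Proof.
move=> [sv s_ind] m x xm; set l := pairs s v.
have [u ux] := in_level_map ((fixed_orbP m x).1 xm).
have [g xg] := orb_eltE x.
have su : size u = size s by rewrite -(size_map (@std_emb F m)) ux xg size_map.
have u_ind : independent u.
  by rewrite -(independent_map (std_embP F m)) ux xg (independent_map (autP g)).
pose I := {w : V_ m 0 | `[< ~ span_of u w /\ pairs u w = l >]}.
have yP (w : I) : exists y : orbit_of (v :: s), orb_elt y = std_emb (sval w) :: orb_elt x.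
  have /asboolP[uw pw] := svalP w.
  have [|||h hs hv] := @witt_step _ _ (@infSpace_nondegenerate F) (map g s) (g v) (std_emb (sval w)).
  - by rewrite (span_of_map (autP g)).
  - by rewrite -xg -ux (span_of_map (std_embP F m)).
  - by rewrite (pairs_map (autP g)) -xg -ux (pairs_map (std_embP F m)) pw.
  apply: (@orb_ex _ _ _ (h * g)%g); rewrite /= -hv; congr (_ :: _).
  by rewrite xg -[LHS]((fixes_map _ _).1 hs) -map_comp.
pose e w := sval (cid (yP w)).
have eE w : orb_elt (e w) = std_emb (sval w) :: orb_elt x by rewrite /e; case: cid.
have emb_inj : injective (@std_emb F m) by case: (std_embP F m).
exists #|{: I}|.
  apply: (has_card_fin (e := e)) => [w w' /(congr1 (@orb_elt _ _))|y].
    by rewrite !eE => -[/emb_inj ww]; apply: val_inj.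
  split=> [[ym yx]|[w <-]]; last first.
    split; last by apply: orb_elt_inj; rewrite orb_elt_proj eE.
    apply/fixed_orbP => z; rewrite eE inE => /predU1P[->|]; first by exists (sval w).
    exact: (fixed_orbP m x).1.
  have [h yh] := orb_eltE y.
  have xh : orb_elt x = map h s by rewrite -yx orb_elt_proj yh.
  have [w hw] : in_level m (h v) by apply: (fixed_orbP m y).1 ym _ _; rewrite yh mem_head.
  have wP : `[< ~ span_of u w /\ pairs u w = l >].
    apply/asboolP; rewrite -(span_of_map (std_embP F m)) -(pairs_map (std_embP F m)).
    by rewrite ux xh hw (span_of_map (autP h)) (pairs_map (autP h)).
  exists (exist _ w wP); apply: orb_elt_inj.
  by rewrite eE /= hw xh yh.
have lincombE a : pairs u (lincomb u a) = pairs s (lincomb s a).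
  rewrite -(pairs_map (std_embP F m)) -(lincomb_map (std_embP F m)) ux xg.
  by rewrite (lincomb_map (autP g)) (pairs_map (autP g)).
set c := #|[pred a : (size s).-tuple F | _]|.
have Ic : (#|{: I}| + c = #|[pred w | pairs u w == l]|)%N.
  have -> : c = #|[pred a : (size u).-tuple F | pairs u (lincomb u a) == l]|.
    by rewrite /c su; apply: eq_card => a; rewrite !inE lincombE.
  rewrite -(card_image (f := fun a : (size u).-tuple F => lincomb u a)); last exact: lincomb_inj.
  rewrite card_sig addnC -[RHS](cardID [pred w | `[< span_of u w >]]).
  congr (_ + _)%N; apply: eq_card => w; rewrite !inE.
    apply/imageP/andP => [[a] |[/eqP uw /asboolP/span_ofP[a aw _]]].
      rewrite inE => al ->; rewrite al; split=> //; apply/asboolP/span_ofP; by exists a.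
    by exists a; rewrite ?inE ?aw ?uw.
  rewrite asbool_and asbool_neg; congr (_ && _); exact/asboolP/eqP.
have := card_pairs u_ind (_ : size l = size u).
rewrite -Ic su size_map => /(_ erefl) IcE.
rewrite /proj_poly hornerD hornerN hornerZ hornerX hornerC.
rewrite -natrX -IcE mulnC natrM natrX.
rewrite mulrCA Zinv_invK natrD addrK //.
Qed.

Lemma count_poly_ex Y X (f : smoothMap Y X) : exists P, count_poly f P.
Proof.
elim/smoothMap_ind: Y X / f => [Y X f fb|Z Y X f g [P fP] [Q gQ]|s v vs_ind].
- by exists 1; apply: count_poly_iso.
- by exists (P * Q); apply: count_poly_comp.
- by eexists; apply: count_poly_proj.
Qed.

End Counting.

Section CountingHom.
Variable F : finFieldType.
Local Notation V := (infSpace F).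
Local Notation V_ m n := (stdSpace F m n).
Local Notation q := #|F|.
Local Notation Zq := (Zinv q).

Fixpoint phi_term (s : theta_term F) : {poly Zq} :=
  match s with
  | Tsym Y X f => sval (cid (count_poly_ex f))
  | Tzero => 0
  | Tone => 1
  | Topp s => - phi_term s
  | Tadd s t => phi_term s + phi_term t
  | Tmul s t => phi_term s * phi_term t
  end.

Lemma phi_termP Y X (f : smoothMap Y X) : count_poly f (phi_term (Tsym f)).
Proof. by rewrite /=; case: cid. Qed.

Lemma phi_term_rel s t : theta_rel s t -> phi_term s = phi_term t.
Proof.
elim=> {s t} //=.
- by move=> s t u _ -> _ ->.
- by move=> s s' _ ->.
- by move=> s s' t t' _ -> _ ->.
- by move=> s s' t t' _ -> _ ->.
- by move=> s t u; rewrite addrA.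
- by move=> s t; rewrite addrC.
- by move=> s; rewrite add0r.
- by move=> s; rewrite addNr.
- by move=> s t u; rewrite mulrA.
- by move=> s t; rewrite mulrC.
- by move=> s; rewrite mul1r.
- by move=> s t u; rewrite mulrDl.
- by move=> Y X f /count_poly_iso; apply: count_poly_uniq; exact: phi_termP.
- move=> Z Y X f g; apply: count_poly_uniq; first exact: phi_termP.
  exact: count_poly_comp (phi_termP f) (phi_termP g).
- move=> Y X X' f h n Y' p f' fp.
  rewrite -/(phi_term (Tsym f)).
  rewrite (count_poly_base fp (phi_termP f) (fun i => phi_termP (f' i))).
  by elim/big_rec2: _ => //= i t x _ ->.
Qed.

Definition phi (x : Theta F) : {poly Zq} := phi_term (theta_repr x).

Lemma phi_cl s : phi (theta_cl s) = phi_term s.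
Proof. exact/phi_term_rel/theta_clK. Qed.

Lemma phi_zmod_morphism : zmod_morphism phi.
Proof.
elim/theta_ind => s; elim/theta_ind => t.
by rewrite [- _]theta_oppE [_ + _]theta_addE !phi_cl.
Qed.

Lemma phi_monoid_morphism : monoid_morphism phi.
Proof.
split; first exact: phi_cl.
by elim/theta_ind => s; elim/theta_ind => t; rewrite [_ * _]theta_mulE !phi_cl.
Qed.

HB.instance Definition _ :=
  GRing.isZmodMorphism.Build (Theta F) {poly Zq} phi phi_zmod_morphism.
HB.instance Definition _ :=
  GRing.isMonoidMorphism.Build (Theta F) {poly Zq} phi phi_monoid_morphism.

Lemma phi_symbP Y X (f : smoothMap Y X) : count_poly f (phi [symb f]).
Proof. by rewrite phi_cl; apply: phi_termP. Qed.

Lemma std_emb_comp_embedding a b m (h : V_ a b -> V_ m 0) :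
  is_embedding (@std_emb F m \o h) <-> is_embedding h.
Proof.
have mP := std_embP F m; have [_ m_inj m_form] := mP.
split=> [[hl hi hf]|]; last exact: is_embedding_comp.
split=> [c u v|u v uv|u v].
- by apply: m_inj; rewrite (embeddingP mP); apply: hl.
- by apply: hi; rewrite /= uv.
- by rewrite -m_form -hf.
Qed.

Section Fibres.
Variables (a b : nat) (Y : smoothSet F) (hY : Y -> X_ F a b).
Hypothesis hYP : smooth_iso hY.

Lemma fixed_level_emb m (y : Y) (h : V_ a b -> V_ m 0) :
  (forall v, std_emb (h v) = hY y v) -> fixed m y.
Proof.
have [/bij_inj hY_inj hY_act] := hYP => hyE g gm; apply: hY_inj.
rewrite hY_act; apply: embedding_eq => v /=.
by rewrite -hyE gm //; exists (h v).
Qed.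

Lemma level_emb_ex m (y : Y) : fixed m y ->
  exists h : {ffun V_ a b -> V_ m 0}, forall v, std_emb (h v) = hY y v.
Proof.
move=> ym; have yl v : in_level m (hY y v).
  apply: level_closed => g /ym gy.
  by have [_ hY_act] := hYP; rewrite -[RHS](congr1 (fun z => hY z v) gy) hY_act.
by exists [ffun v => sval (cid (yl v))] => v; rewrite ffunE; case: cid.
Qed.

Lemma has_card_embeddings m (R : Y -> Prop) (Q : {ffun V_ a b -> V_ m 0} -> Prop) :
  (forall y (h : {ffun V_ a b -> V_ m 0}),
     (forall v, std_emb (h v) = hY y v) -> R y <-> Q h) ->
  has_card (fun y => fixed m y /\ R y)
    #|[set h : {ffun V_ a b -> V_ m 0} | `[< is_embedding h /\ Q h >]]|.
Proof.
move=> RQ; have [[x hYK hKY] _] := hYP.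
have emb_inj : injective (@std_emb F m) by case: (std_embP F m).
pose I := {h : {ffun V_ a b -> V_ m 0} | `[< is_embedding h /\ Q h >]}.
have hP (i : I) : is_embedding (@std_emb F m \o sval i).
  by apply/std_emb_comp_embedding; have /asboolP[] := svalP i.
pose e i := x (Embedding (hP i)).
have eE (i : I) v : std_emb (sval i v) = hY (e i) v by rewrite /e hKY.
have -> : #|[set h : {ffun V_ a b -> V_ m 0} | `[< is_embedding h /\ Q h >]]| = #|{: I}|.
  by rewrite card_sig cardsE.
apply: (has_card_fin (e := e)) => [i j ij|y].
  by apply/val_inj/ffunP => v; apply: emb_inj; rewrite !eE ij.
split=> [[ym Ry]|[i <-]].
  have [h hyE] := level_emb_ex ym.
  have hQ : `[< is_embedding h /\ Q h >].
    apply/asboolP; split; last exact/(RQ y).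
    apply/std_emb_comp_embedding; case: (embP (hY y)) => yl yi yf.
    by rewrite (_ : _ \o _ = hY y) //; apply/funext.
  exists (exist _ h hQ); apply: (can_inj hYK); apply: embedding_eq => v.
  by rewrite -eE hyE.
split; first exact: fixed_level_emb (eE i).
by apply/(RQ _ _ (eE i)); have /asboolP[] := svalP i.
Qed.

End Fibres.

Lemma phi_counting_hom : counting_hom phi.
Proof.
split=> [a b X h hP m|a b a' b' j Y X f hX hY hXP hYP hf].
  have [|N XN ->] := phi_symbP (to_pt X) (m := m) (x := tt); first by [].
  have := has_card_embeddings hP (m := m) (R := fun y => to_pt X y = tt) (Q := fun=> True).
  move=> /(_ (fun _ _ _ => conj (fun=> I) (fun=> erefl)))/(has_card_uniq XN)->.
  by congr _%:R; apply: eq_card => k; rewrite !inE; apply/asboolP/asboolP => [[]|].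
exists 0 => m _ i.
have [[x hXK hKX] _] := hXP.
have iP : is_embedding (@std_emb F m \o i) by apply/std_emb_comp_embedding/embP.
have xE v : std_emb (i v) = hX (x (Embedding iP)) v by rewrite hKX.
have [|N fN ->] := phi_symbP f (m := m) (x := x (Embedding iP)).
  exact: (fixed_level_emb hXP (h := i) xE).
congr _%:R; apply: has_card_uniq fN _; apply: (has_card_embeddings hYP) => y h hyE.
split=> [fy v|hij].
  have [_ emb_inj _] := std_embP F m; apply: emb_inj.
  by rewrite hyE xE -fy hf.
apply: (can_inj hXK); rewrite hf hKX; apply: embedding_eq => v /=.
by rewrite -hyE hij.
Qed.

Lemma theta_one_neq0 : (1 : Theta F) != 0.
Proof.
by apply/eqP => /(congr1 phi)/eqP; rewrite rmorph1 rmorph0 oner_eq0.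
Qed.

HB.instance Definition _ :=
  GRing.PzSemiRing_isNonZero.Build (Theta F) theta_one_neq0.

Let tau_const := #|[pred a : 0.-tuple F |
  pairs [::] (lincomb [::] a : V) == pairs [::] (e_ F 0)]|.

Definition theta_t : Theta F := tau F + tau_const%:R.

Lemma phi_theta_t : phi theta_t = 'X.
Proof.
rewrite rmorphD rmorph_nat /= -/(phi (tau F)).
rewrite (count_poly_uniq (phi_symbP _) (count_poly_proj (independent_e0 F))).
by rewrite /proj_poly expr0 scale1r polyC_natr subrK.
Qed.

Definition theta_eval : {poly int} -> Theta F :=
  horner_morph (fun a : int => mulrC theta_t a%:~R).

HB.instance Definition _ := GRing.RMorphism.on theta_eval.

Lemma theta_evalX : theta_eval 'X = theta_t.
Proof. exact: horner_morphX. Qed.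

Lemma phi_eval (p : {poly int}) : phi (theta_eval p) = map_poly intr p.
Proof.
elim/poly_ind: p => [|p c IH]; first by rewrite !rmorph0.
rewrite !rmorphD !rmorphM /= theta_evalX phi_theta_t map_polyX IH; congr (_ + _).
by rewrite map_polyC /= [theta_eval _]horner_morphC !rmorph_int.
Qed.

Lemma intr_Zq_inj : injective (intr : int -> Zq).
Proof.
move=> x y /(congr1 (val : Zq -> rat)); rewrite !rmorph_int => /eqP.
by rewrite eqr_int => /eqP.
Qed.

Definition scaled_eval (x : Theta F) : Prop :=
  exists k p, x *+ q ^ k = theta_eval p.

Lemma scaled_evalD x y : scaled_eval x -> scaled_eval y -> scaled_eval (x + y).
Proof.
move=> [k [p xp]] [l [r yr]]; exists (k + l)%N, (p *+ q ^ l + r *+ q ^ k).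
rewrite rmorphD !rmorphMn /= -xp -yr mulrnDl -!mulrnA -!expnD.
by rewrite [(l + k)%N]addnC.
Qed.

Lemma scaled_evalM x y : scaled_eval x -> scaled_eval y -> scaled_eval (x * y).
Proof.
move=> [k [p xp]] [l [r yr]]; exists (k + l)%N, (p * r).
by rewrite rmorphM /= -xp -yr mulrnAl mulrnAr -mulrnA -expnD addnC.
Qed.

Lemma scaled_eval_eval p : scaled_eval (theta_eval p).
Proof. by exists 0, p. Qed.

Lemma scaled_eval_symb Y X (f : smoothMap Y X) : scaled_eval [symb f].
Proof.
elim/smoothMap_ind: Y X / f => [Y X f fb|Z Y X f g fi gi|s v vs_ind].
- by rewrite symb_iso // -(rmorph1 theta_eval); apply: scaled_eval_eval.
- by rewrite symb_comp; apply: scaled_evalM.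
have [k [N [c vsE]]] := symb_proj_tau vs_ind; exists k, (('X - tau_const%:R) *+ N + c%:~R).
rewrite vsE rmorphD rmorphMn rmorphB rmorph_nat rmorph_int /= theta_evalX.
by rewrite /theta_t addrK.
Qed.

Lemma scaled_eval_theta x : scaled_eval x.
Proof.
elim/theta_ind: x; elim => [Y X f|||s [k [p sp]]|s IHs t IHt|s IHs t IHt].
- exact: scaled_eval_symb.
- by rewrite -[theta_cl _]/(0 : Theta F) -(rmorph0 theta_eval); apply: scaled_eval_eval.
- by rewrite -[theta_cl _]/(1 : Theta F) -(rmorph1 theta_eval); apply: scaled_eval_eval.
- exists k, (- p); by rewrite rmorphN /= -sp -theta_oppE -mulNrn.
- by rewrite -theta_addE; apply: scaled_evalD.
- by rewrite -theta_mulE; apply: scaled_evalM.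
Qed.

Lemma loc_phi_inj : injective (loc_map q phi).
Proof.
move=> u v uv; apply/eqP; rewrite -subr_eq0; apply/eqP.
have : loc_map q phi (u - v) = 0 by rewrite rmorphB /= uv subrr.
elim/loc_ind: (u - v) => {u v uv} x i; rewrite loc_mapE => /loc_fracP[k].
rewrite addn0 mul0rn => xk; have [j [p xp]] := scaled_eval_theta x.
have pk0 : p *+ q ^ k = 0.
  apply: (map_inj_poly intr_Zq_inj); first exact: rmorph0.
  by rewrite rmorph0 rmorphMn /= -phi_eval -xp rmorphMn /= mulrnAC xk mul0rn.
apply/loc_fracP; exists (j + k)%N.
by rewrite addn0 mul0rn expnD mulrnA xp -rmorphMn pk0 rmorph0.
Qed.

Lemma Zq_poly_intr (P : {poly Zq}) : exists k p, P *+ q ^ k = map_poly intr p.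
Proof.
elim/poly_ind: P => [|P a [k [p Pp]]].
  by exists 0, 0; rewrite mul0rn rmorph0.
have [l [c ac]] : exists l (c : int), a *+ q ^ l = c%:~R.
  have /asboolP[l /intrP[c ac]] := valP a; exists l, c; apply: val_inj.
  by rewrite rmorphMn rmorph_int -ac /= -natrX mulr_natr.
exists (k + l)%N, (p *+ q ^ l * 'X + (c *+ q ^ k)%:P).
rewrite rmorphD rmorphM rmorphMn /= map_polyX map_polyC /= -Pp.
rewrite mulrnDl expnD; congr (_ + _); first by rewrite -!mulrnA -mulrnAl.
by rewrite rmorphMn /= -ac -mulrnA mulnC -polyCMn.
Qed.

Lemma loc_phi_surj (u : loc q {poly Zq}) : exists v, loc_map q phi v = u.
Proof.
elim/loc_ind: u => P i; have [k [p Pp]] := Zq_poly_intr P.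
exists (loc_frac q (theta_eval p) (k + i)); rewrite loc_mapE /= phi_eval -Pp.
by apply/loc_fracP; exists 0; rewrite !add0n expnD mulrnA.
Qed.

Lemma loc_phi_bij : bijective (loc_map q phi).
Proof.
pose g u := sval (cid (loc_phi_surj u)).
have gK : cancel g (loc_map q phi) by move=> u; rewrite /g; case: cid.
by exists g => // u; apply: loc_phi_inj; rewrite gK.
Qed.

End CountingHom.

Theorem proposition8p11 (F : finFieldType) :
  exists2 phi : {rmorphism Theta F -> {poly Zinv #|F|}},
    counting_hom phi & bijective (loc_map #|F| phi).
Proof. by exists (@phi F); [exact: phi_counting_hom | exact: loc_phi_bij]. Qed.
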